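(* Let $r\geq 3$ and let $n$ be sufficiently large. (i) If $\ell$ is an odd integer with $\ell\geq 2r+11$, then $$ {\rm ex}_r(n,{\rm Berge}\text{-}P_\ell\cup P_1)=\max\left\{{\rm ex}_r(n,{\rm Berge}\text{-}P_\ell),\ \binom{\frac{\ell+1}{2}}{r-1}\left(n-\frac{\ell+1}{2}\right)+\binom{\frac{\ell+1}{2}}{r}\right\}. $$ (ii) If $\ell_1,\ell_2$ are odd integers with $\ell_1\geq \ell_2\geq r+6$, then $$ {\rm ex}_r(n,{\rm Berge}\text{-}P_{\ell_1}\cup P_{\ell_2})=\max\left\{{\rm ex}_r(n,{\rm Berge}\text{-}P_{\ell_1}),\ \binom{\frac{\ell_1+\ell_2}{2}}{r-1}\left(n-\frac{\ell_1+\ell_2}{2}\right)+\binom{\frac{\ell_1+\ell_2}{2}}{r}\right\}. $$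
   Context: An $r$-graph is a hypergraph whose hyperedges are distinct $r$-element subsets of the vertex set. For a graph $F$, an $r$-graph $H$ is a Berge-$F$ if there is a bijection $\phi:E(F)\to E(H)$ with $e\subseteq\phi(e)$ for each $e\in E(F)$; an $r$-graph contains a Berge-$F$ if some subhypergraph is a Berge-$F$. ${\rm ex}_r(n,{\rm Berge}\text{-}F)$ is the maximum number of hyperedges in an $n$-vertex $r$-graph containing no Berge-$F$. $P_m$ is the path with $m$ edges ($P_1$ is a single edge) and $\cup$ denotes vertex-disjoint union. Convention: $\binom{a}{b}=0$ if $a<b$. *)

(* Defs.v *)
From mathcomp Require Import all_boot.

Set Implicit Arguments.
Unset Strict Implicit.
Unset Printing Implicit Defensive.

Record sgraph := SGraph {
  svertex :> finType;
  sadj : rel svertex;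
  sadj_sym : symmetric sadj;
  sadj_irrefl : irreflexive sadj
}.

Definition edges (F : sgraph) : {set {set F}} :=
  [set [set x; y] | x in F, y in F & sadj x y].

Section PathGraph.
Variable m : nat.

Definition path_adj : rel 'I_m.+1 := fun i j => (i.+1 == j) || (j.+1 == i).

Lemma path_adj_sym : symmetric path_adj.
Proof. by move=> i j; rewrite /path_adj orbC. Qed.

Lemma path_adj_irrefl : irreflexive path_adj.
Proof. by move=> i; rewrite /path_adj orbb gtn_eqF. Qed.

(* The index is the number of edges: [path_graph m] has m + 1 vertices. *)
Definition path_graph : sgraph := SGraph path_adj_sym path_adj_irrefl.

End PathGraph.

Section DisjointUnion.
Variables F G : sgraph.

Definition union_adj : rel (F + G)%type := fun u v =>
  match u, v with
  | inl x, inl y => sadj x y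
  | inr x, inr y => sadj x y
  | _, _ => false
  end.

Lemma union_adj_sym : symmetric union_adj.
Proof. by case=> x [] y //=; apply: sadj_sym. Qed.

Lemma union_adj_irrefl : irreflexive union_adj.
Proof. by case=> x /=; apply: sadj_irrefl. Qed.

Definition disjoint_union : sgraph := SGraph union_adj_sym union_adj_irrefl.

End DisjointUnion.

Definition uniform (T : finType) (r : nat) (H : {set {set T}}) : bool :=
  [forall e in H, #|e| == r].

(* The vertices of F are placed in T by the injection f, so that the condition
   "e is contained in phi(e)" reads f @: e \subset phi e. Only the values of
   phi on the edges of F matter. *)
Definition is_Berge (F : sgraph) (T : finType) (H : {set {set T}}) : bool :=
  [exists f : {ffun F -> T}, exists phi : {ffun {set F} -> {set T}},
    [&& injectiveb f,
        dinjectiveb phi (mem (edges F)),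
        phi @: edges F == H
      & [forall e in edges F, f @: e \subset phi e]]].

Definition contains_Berge (F : sgraph) (T : finType) (H : {set {set T}}) :
    bool :=
  [exists H' : {set {set T}}, (H' \subset H) && is_Berge F H'].

(* The range of the maximum can be empty only for an edgeless F (the edgeless
   r-graph is admissible otherwise); the value is then 0. *)
Definition ex_Berge (r n : nat) (F : sgraph) : nat :=
  \max_(H : {set {set 'I_n}} | uniform r H && ~~ contains_Berge F H) #|H|.

(* Main.v *)
(* Proof idea.  Put a = (l1 + l2) / 2 and D = C(a, r-1).  The lower bound comes
   from the r-sets with at most one vertex outside a fixed a-set: every edge of
   a Berge path then has a core vertex in the a-set, and two odd paths need
   a + 1 such vertices.

   For the upper bound let H contain a path with l1 edges but no disjoint pair;
   in particular H has no path with 2a + 1 edges.  The components of the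
   2-shadow missing the long path are free of paths with l2 edges and have
   fewer than D edges per vertex.  In the component C of the long path, delete
   one or two vertices at a time as long as connectivity is preserved and fewer
   than D edges per vertex are lost.  Either this consumes almost all of C,
   which makes H too sparse, or it stops at a large connected set W.

   Since paths in W are bounded, some bounded set S leaves many components of
   W - S.  In each of them take a longest path s, x1, ..., xp = y starting at
   some s in S.  By pigeonhole many components agree on s, p and on the set B of
   vertices of S joined to y.  Non-extendability shows that y has about
   C(p - 1 + |B|, r-1) edges, so p - 1 + |B| >= a, while running through B with a
   new component between any two consecutive vertices gives a path with
   2(p - 1 + |B|) edges.  So p - 1 + |B| = a, and every gain of one more edge is
   excluded.  This leaves p = 1, or a clique-like block hanging on s, which the
   deletion process would have attacked.  If p = 1, then B is an a-set each
   vertex of which is joined to many common vertices by edges inside B plus one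
   vertex, and such a set allows no vertex outside it to have more than D edges
   unless it avoids B altogether, which gives the exact bound. *)

Require Import Defs.
From Stdlib Require Import Classical.
From mathcomp Require Import all_boot zify.

Set Implicit Arguments.
Unset Strict Implicit.
Unset Printing Implicit Defensive.

(** * Berge paths *)

Section BergePaths.
Variables (T : finType) (H : {set {set T}}).
Implicit Types (v u : T) (l : seq ({set T} * T)).

(** A Berge walk is stored as its start vertex and a list of steps, each pairing a hyperedge with
    the vertex reached through it. Thus [size l] is the number of edges, and the empty list is a
    path at every vertex. *)
Fixpoint walk v l : bool :=
  if l is (e, u) :: l' then [&& e \in H, v \in e, u \in e & walk u l'] else true.

Definition verts v l : seq T := v :: unzip2 l.
Definition pend v l : T := last v (unzip2 l).
Definition bpath v l : bool :=
  [&& walk v l, uniq (verts v l) & uniq (unzip1 l)].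

Lemma walk_cat v l1 l2 :
  walk v (l1 ++ l2) = walk v l1 && walk (pend v l1) l2.
Proof.
elim: l1 v => [|[e u] l1 IH] v //=.
by rewrite IH -!andbA.
Qed.

Lemma pend_cat v l1 l2 : pend v (l1 ++ l2) = pend (pend v l1) l2.
Proof. by rewrite /pend /unzip2 map_cat last_cat. Qed.

Lemma pend_rcons v l e u : pend v (rcons l (e, u)) = u.
Proof. by rewrite /pend /unzip2 map_rcons last_rcons. Qed.

Lemma verts_rcons v l e u : verts v (rcons l (e, u)) = rcons (verts v l) u.
Proof. by rewrite /verts /unzip2 map_rcons. Qed.

Lemma pend_in v l : pend v l \in verts v l.
Proof. exact: mem_last. Qed.

Lemma bpath_rcons v l e u :
  bpath v (rcons l (e, u)) =
  [&& bpath v l, e \in H, pend v l \in e, u \in e,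
      u \notin verts v l & e \notin unzip1 l].
Proof.
rewrite /bpath verts_rcons rcons_uniq /unzip1 map_rcons rcons_uniq.
rewrite -cats1 walk_cat /= andbT.
rewrite /unzip1; apply/idP/idP.
- by case/and3P=> /and4P[-> -> -> ->] /andP[-> ->] /andP[-> ->].
- by case/and5P=> /and3P[-> -> ->] -> -> -> /andP[-> ->].
Qed.

Lemma bpath_cat v l1 l2 :
  bpath v l1 -> bpath (pend v l1) l2 ->
  (forall u, u \in unzip2 l2 -> u \notin verts v l1) ->
  (forall e, e \in unzip1 l2 -> e \notin unzip1 l1) ->
  bpath v (l1 ++ l2).
Proof.
case/and3P=> w1 u1 e1 /and3P[w2 /= /andP[_ u2] e2] dv de.
rewrite /bpath walk_cat w1 w2 andTb.
rewrite /verts /unzip2 /unzip1 !map_cat -cat_cons !cat_uniq.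
rewrite -/(verts v l1) u1 u2 e1 e2 !andbT /=.
by apply/andP; split; apply/hasPn.
Qed.

Lemma bpath_catl v l1 l2 : bpath v (l1 ++ l2) -> bpath v l1.
Proof.
case/and3P; rewrite walk_cat /verts /unzip2 /unzip1 !map_cat -cat_cons !cat_uniq.
by move=> /andP[w1 _] /andP[u1 _] /andP[e1 _]; apply/and3P.
Qed.

Lemma bpath_take n v l : bpath v l -> bpath v (take n l).
Proof. by rewrite -{1}(cat_take_drop n l); apply: bpath_catl. Qed.

Lemma bpath_catr v l1 l2 : bpath v (l1 ++ l2) -> bpath (pend v l1) l2.
Proof.
case/and3P; rewrite walk_cat => /andP[w1 w2] uv ue; apply/and3P; split=> //.
- move: uv; rewrite /verts /unzip2 map_cat -cat_cons lastI -/(unzip2 l1) -/(pend v l1).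
  by rewrite cat_rcons cat_uniq => /and3P[].
- by move: ue; rewrite /unzip1 map_cat cat_uniq => /and3P[].
Qed.

(** Reversal pairs each edge with its other path vertex, so the reversed steps are not [rev l]; they
    are described through their vertices and edges separately. *)
Lemma walk_rev v l : walk v l ->
  exists l', [/\ walk (pend v l) l', pend (pend v l) l' = v,
    verts (pend v l) l' = rev (verts v l) & unzip1 l' = rev (unzip1 l)].
Proof.
elim: l v => [|[e u] l IH] v /=; first by exists [::].
case/and4P=> eH ve ue /IH[l' [w p vs es]].
exists (rcons l' (e, v)).
rewrite -[pend v _]/(pend u l) pend_rcons verts_rcons vs -rev_cons.
rewrite -cats1 walk_cat /= w p eH ve ue; split=> //.
by rewrite /unzip1 map_cat -/(unzip1 l') es /= rev_cons cats1.
Qed.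

Lemma bpath_rev v l : bpath v l ->
  exists l', [/\ bpath (pend v l) l', pend (pend v l) l' = v, size l' = size l,
    verts (pend v l) l' = rev (verts v l) & unzip1 l' = rev (unzip1 l)].
Proof.
case/and3P=> w uv ue; have [l' [w' p' vs es]] := walk_rev w.
exists l'; split=> //; first by rewrite /bpath w' vs es !rev_uniq uv ue.
by rewrite -(size_map fst) -/(unzip1 l') es size_rev size_map.
Qed.

Lemma bpath_edge v l e : bpath v l -> e \in unzip1 l ->
  e \in H /\ exists w u,
    [/\ w \in verts v l, u \in unzip2 l, w \in e, u \in e & w != u].
Proof.
elim: l v => [|[e' u'] l IH] v //= /and3P[/= /and4P[e'H ve u'e w] uv ue].
rewrite inE => /orP[/eqP->|el].
  split=> //; exists v, u'; rewrite !inE !eqxx /= ?orbT; split=> //.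
  by move: uv; rewrite !inE negb_or -andbA => /andP[].
have [|eH [w' [u [w'v uv' w'e ue' wu]]]] := IH u' _ el.
  by rewrite /bpath w /=; case/andP: uv => _ /= ->; case/andP: ue.
split=> //; exists w', u; rewrite !inE uv' orbT.
by split=> //; move: w'v; rewrite /verts !inE => /orP[] ->; rewrite ?orbT.
Qed.

Lemma bpath_mem_edges v l e : bpath v l -> e \in unzip1 l -> e \in H.
Proof. by move=> b /(bpath_edge b)[]. Qed.

Lemma walk_nth v l : walk v l <-> forall i, i < size l ->
  [/\ nth set0 (unzip1 l) i \in H, nth v (verts v l) i \in nth set0 (unzip1 l) i
    & nth v (verts v l) i.+1 \in nth set0 (unzip1 l) i].
Proof.
split.
- elim: l v => [|[e u] l IH] v //= /and4P[eH ve ue w] [_|i] //=.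
  rewrite ltnS => lti; have [h1 h2 h3] := IH _ w _ lti; split=> //.
    by rewrite (set_nth_default u) //= size_map; apply: ltnW.
  by move: h3; rewrite /= (set_nth_default v) //= size_map.
- elim: l v => [|[e u] l IH] v //= hl.
  have [/= -> -> ->] := hl 0 isT; apply: IH => i lti.
  have [/= h1 h2 h3] := hl i.+1 lti; split=> //.
    by rewrite (set_nth_default v) //= size_map; apply: ltnW.
  by rewrite /= (set_nth_default v) //= size_map.
Qed.

(** Induction on the room [N - size l0] left below the bound; classical logic decides whether a
    longer path with [P] exists, as [P] is an arbitrary proposition. *)
Lemma exists_longest (P : T -> seq ({set T} * T) -> Prop) N v0 l0 :
  P v0 l0 -> (forall v l, P v l -> size l <= N) ->
  exists v l, P v l /\ forall v' l', P v' l' -> size l' <= size l.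
Proof.
move=> P0 bd; have [m] := ubnP (N - size l0).
elim: m v0 l0 P0 => [|m IH] v l Pl hm; first by [].
case: (classic (exists v' l', P v' l' /\ size l < size l')).
  move=> [v' [l' [P' lt]]]; apply: (IH v' l') => //.
  by have := bd _ _ P'; lia.
move=> nex; exists v, l; split=> // v' l' P'.
by rewrite leqNgt; apply/negP => lt; apply: nex; exists v', l'.
Qed.

End BergePaths.

Lemma bpath_sub (T : finType) (H H' : {set {set T}}) v l :
  H \subset H' -> bpath H v l -> bpath H' v l.
Proof.
move=> /subsetP sub /and3P[w u e]; apply/and3P; split=> //.
elim: l v w {u e} => [|[e u] l IH] v //= /and4P[eH -> -> w].
by rewrite sub //= IH.
Qed.

(** * Translation between Berge copies and Berge paths *)

Section BergeGraphs.
Variable (T : finType).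
Implicit Types (H : {set {set T}}).

(** The hyperedges are given on ordered pairs, which suits indexed paths; [phi] picks one
    orientation of each edge, so [psi] may differ on [x, y] and [y, x]. *)
Lemma contains_BergeI (F : sgraph) H (f : F -> T) (psi : F -> F -> {set T}) :
  injective f ->
  (forall x y, sadj x y -> [/\ psi x y \in H, f x \in psi x y & f y \in psi x y]) ->
  (forall x y x' y', sadj x y -> sadj x' y' -> psi x y = psi x' y' ->
     [set x; y] = [set x'; y']) ->
  contains_Berge F H.
Proof.
move=> injf hpsi injpsi.
pose phi (e : {set F}) :=
  if [pick p : F * F | sadj p.1 p.2 && (e == [set p.1; p.2])] is Some p
  then psi p.1 p.2 else set0.
have phiE e : e \in edges F ->
    exists x y, [/\ sadj x y, e = [set x; y] & phi e = psi x y].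
  case/imset2P=> x y _; rewrite inE => /andP[_ xy] ->; rewrite /phi.
  case: pickP => [[x' y'] /= /andP[a /eqP ->]|/(_ (x, y))].
    by exists x', y'.
  by rewrite /= xy eqxx.
apply/existsP; exists ([ffun e => phi e] @: edges F).
apply/andP; split.
  apply/subsetP=> _ /imsetP[e /phiE[x [y [xy _ pe]]] ->].
  by rewrite ffunE pe; case: (hpsi _ _ xy).
apply/existsP; exists (finfun f); apply/existsP; exists [ffun e => phi e].
apply/and4P; split=> //.
- by apply/injectiveP => x y; rewrite !ffunE; apply: injf.
- apply/dinjectiveP => e e' /phiE[x [y [xy -> pe]]] /phiE[x' [y' [xy' -> pe']]].
  by rewrite !ffunE pe pe'; apply: injpsi.
- apply/forall_inP=> e /phiE[x [y [xy -> pe]]].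
  rewrite ffunE pe; have [_ fx fy] := hpsi _ _ xy.
  apply/subsetP=> _ /imsetP[z zin ->]; rewrite ffunE.
  by move: zin; rewrite !inE => /orP[]/eqP->.
Qed.

Lemma contains_BergeE (F : sgraph) H : contains_Berge F H ->
  exists (f : F -> T) (phi : {set F} -> {set T}),
  [/\ injective f,
      forall x y, sadj x y -> [/\ phi [set x; y] \in H,
          f x \in phi [set x; y] & f y \in phi [set x; y]]
    & forall x y x' y', sadj x y -> sadj x' y' ->
        phi [set x; y] = phi [set x'; y'] -> [set x; y] = [set x'; y']].
Proof.
case/existsP=> H' /andP[/subsetP sub].
case/existsP=> f /existsP[phi /and4P[/injectiveP injf /dinjectiveP injp /eqP im /forall_inP fs]].
have edgeI x y : sadj x y -> [set x; y] \in edges F.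
  by move=> xy; apply/imset2P; exists x y; rewrite ?inE.
exists f, phi; split=> //.
- move=> x y xy; have eE := edgeI _ _ xy.
  have /subsetP s := fs _ eE.
  by split; [apply: sub; rewrite -im imset_f | apply: s | apply: s];
    rewrite ?imset_f ?inE ?eqxx ?orbT.
- by move=> x y x' y' xy xy'; apply: injp; apply: edgeI.
Qed.

(** The smaller endpoint serves as the index of an edge of the path, in either orientation. *)
Lemma path_adj_min m (i j : 'I_m.+1) : path_adj i j ->
  minn i j < m /\ [set i; j] = [set inord (minn i j); inord (minn i j).+1].
Proof.
rewrite /path_adj => ij; case/orP: (ij) => /eqP E.
- have -> : minn i j = i by lia.
  rewrite inord_val E inord_val; split=> //; have := ltn_ord j; lia.
- have -> : minn i j = j by lia.
  rewrite inord_val E inord_val setUC; split=> //; have := ltn_ord i; lia.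
Qed.

Lemma path_adj_nth H v l (i j : 'I_(size l).+1) : walk H v l -> path_adj i j ->
  [/\ nth set0 (unzip1 l) (minn i j) \in H,
      nth v (verts v l) i \in nth set0 (unzip1 l) (minn i j)
    & nth v (verts v l) j \in nth set0 (unzip1 l) (minn i j)].
Proof.
move=> /walk_nth w ij; have [lt _] := path_adj_min ij.
have [h1 h2 h3] := w _ lt; split=> //.
- case/orP: ij => /eqP E.
    by move: h2; have -> : minn i j = i by lia.
  by move: h3; rewrite (_ : minn i j = j) ?E //; lia.
- case/orP: ij => /eqP E.
    by move: h3; rewrite (_ : minn i j = i) ?E //; lia.
  by move: h2; have -> : minn i j = j by lia.
Qed.

Lemma nth_verts_inj (v : T) l (i j : 'I_(size l).+1) : uniq (verts v l) ->
  nth v (verts v l) i = nth v (verts v l) j -> i = j.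
Proof.
move=> u /eqP; rewrite nth_uniq ?ltn_ord // /verts /= ?size_map ?ltn_ord //.
by move=> /eqP E; apply: val_inj.
Qed.

Lemma nth_edges_inj (l : seq ({set T} * T)) (i j i' j' : 'I_(size l).+1) :
  uniq (unzip1 l) -> path_adj i j -> path_adj i' j' ->
  nth set0 (unzip1 l) (minn i j) = nth set0 (unzip1 l) (minn i' j') ->
  [set i; j] = [set i'; j'].
Proof.
move=> u ij ij' /eqP.
have [lt ->] := path_adj_min ij; have [lt' ->] := path_adj_min ij'.
by rewrite nth_uniq ?size_map // => /eqP ->.
Qed.

Lemma contains_path H v l : bpath H v l ->
  contains_Berge (path_graph (size l)) H.
Proof.
case/and3P=> w uv ue.
apply: (@contains_BergeI (path_graph (size l)) H (fun i => nth v (verts v l) i)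
  (fun i j => nth set0 (unzip1 l) (minn i j))).
- by move=> i j; apply: nth_verts_inj.
- by move=> i j; apply: path_adj_nth.
- by move=> i j i' j'; apply: nth_edges_inj.
Qed.

Lemma contains_two_paths H v1 l1 v2 l2 :
  bpath H v1 l1 -> bpath H v2 l2 ->
  (forall u, u \in verts v1 l1 -> u \notin verts v2 l2) ->
  (forall e, e \in unzip1 l1 -> e \notin unzip1 l2) ->
  contains_Berge (disjoint_union (path_graph (size l1)) (path_graph (size l2))) H.
Proof.
case/and3P=> w1 uv1 ue1 /and3P[w2 uv2 ue2] dv de.
have vin v (l : seq ({set T} * T)) (i : 'I_(size l).+1) :
    nth v (verts v l) i \in verts v l.
  by rewrite mem_nth //= size_map ltn_ord.
have ein (l : seq ({set T} * T)) (i j : 'I_(size l).+1) : path_adj i j ->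
    nth set0 (unzip1 l) (minn i j) \in unzip1 l.
  by move=> /path_adj_min[lt _]; rewrite mem_nth // size_map.
pose f (x : 'I_(size l1).+1 + 'I_(size l2).+1) :=
  match x with inl i => nth v1 (verts v1 l1) i | inr i => nth v2 (verts v2 l2) i end.
pose psi (x y : 'I_(size l1).+1 + 'I_(size l2).+1) :=
  match x, y with
  | inl i, inl j => nth set0 (unzip1 l1) (minn i j)
  | inr i, inr j => nth set0 (unzip1 l2) (minn i j)
  | _, _ => set0 end.
have imS (A B : finType) (h : A -> B) x y : [set h x; h y] = h @: [set x; y].
  by rewrite imsetU1 imset_set1.
apply: (@contains_BergeI (disjoint_union (path_graph (size l1)) (path_graph (size l2))) H f psi).
- case=> i [] j /= E.
  + by congr inl; apply: nth_verts_inj E.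
  + by have := dv _ (vin v1 l1 i); rewrite E vin.
  + by have := dv _ (vin v1 l1 j); rewrite -E vin.
  + by congr inr; apply: nth_verts_inj E.
- by case=> i [] j //= ij; apply: path_adj_nth.
- case=> i [] j // [] i' [] j' //= ij ij' E.
  + by rewrite !imS (nth_edges_inj ue1 ij ij' E).
  + by have := de _ (ein l1 _ _ ij); rewrite E ein.
  + by have := de _ (ein l1 _ _ ij'); rewrite -E ein.
  + by rewrite !imS (nth_edges_inj ue2 ij ij' E).
Qed.

Definition steps_of m (g : nat -> T) (h : nat -> {set T}) :=
  mkseq (fun i => (h i, g i.+1)) m.

Lemma verts_steps_of m g h : verts (g 0) (steps_of m g h) = mkseq g m.+1.
Proof.
rewrite /verts /steps_of /unzip2 /mkseq -map_comp /=; congr cons.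
by rewrite (iotaDl 1 0 m) -map_comp; apply: eq_map.
Qed.

Lemma unzip1_steps_of m g h : unzip1 (steps_of m g h) = mkseq h m.
Proof. by rewrite /steps_of /unzip1 /mkseq -map_comp; apply: eq_map. Qed.

Lemma bpath_steps_of H m g h :
  (forall i, i < m -> [/\ h i \in H, g i \in h i & g i.+1 \in h i]) ->
  (forall i j, i <= m -> j <= m -> g i = g j -> i = j) ->
  (forall i j, i < m -> j < m -> h i = h j -> i = j) ->
  bpath H (g 0) (steps_of m g h).
Proof.
move=> hw ginj hinj; apply/and3P; split.
- apply/walk_nth => i; rewrite size_mkseq => lti.
  rewrite verts_steps_of unzip1_steps_of !nth_mkseq //; last by rewrite ltnS ltnW.
  exact: hw.
- by rewrite verts_steps_of; apply/mkseq_uniqP => i j; rewrite !inE => hi hj; apply: ginj.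
- by rewrite unzip1_steps_of; apply/mkseq_uniqP => i j; rewrite !inE => hi hj; apply: hinj.
Qed.

Lemma inord_step_inj m i j : i < m -> j < m ->
  [set inord i; inord i.+1] = [set inord j; inord j.+1] :> {set 'I_m.+1} -> i = j.
Proof.
move=> hi hj /setP E.
have := E (inord i); rewrite !inE eqxx /= => /esym/orP[]/eqP/(congr1 val); rewrite /= !inordK; try lia.
have := E (inord j); rewrite !inE eqxx /= => /orP[]/eqP/(congr1 val); rewrite /= !inordK; lia.
Qed.

Lemma contains_pathE H m : contains_Berge (path_graph m) H ->
  exists v l, bpath H v l /\ size l = m.
Proof.
case/contains_BergeE=> f [phi [injf hphi injphi]].
pose g i := f (inord i); pose h i := phi [set inord i; inord i.+1].
have adj i : i < m -> @sadj (path_graph m) (inord i) (inord i.+1).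
  by move=> hi; rewrite /= /path_adj !inordK ?eqxx //; lia.
exists (g 0), (steps_of m g h); split; last by rewrite size_mkseq.
apply: bpath_steps_of.
- by move=> i /adj; apply: hphi.
- by move=> i j hi hj /injf/(congr1 val); rewrite /= !inordK.
- by move=> i j hi hj /(injphi _ _ _ _ (adj _ hi) (adj _ hj)); apply: inord_step_inj.
Qed.

Lemma contains_two_pathsE H m1 m2 :
  contains_Berge (disjoint_union (path_graph m1) (path_graph m2)) H ->
  exists v1 l1 v2 l2, [/\ bpath H v1 l1, bpath H v2 l2, size l1 = m1, size l2 = m2
    & forall u, u \in verts v1 l1 -> u \notin verts v2 l2].
Proof.
case/contains_BergeE=> f [phi [injf hphi injphi]].
set F := disjoint_union _ _ in f phi injf hphi injphi.
pose in1 i : F := inl (inord i : 'I_m1.+1).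
pose in2 i : F := inr (inord i : 'I_m2.+1).
have adj1 i : i < m1 -> sadj (in1 i) (in1 i.+1).
  by move=> hi; rewrite /= /path_adj !inordK ?eqxx //; lia.
have adj2 i : i < m2 -> sadj (in2 i) (in2 i.+1).
  by move=> hi; rewrite /= /path_adj !inordK ?eqxx //; lia.
have inj1 : injective (@inl 'I_m1.+1 'I_m2.+1) by move=> ? ? [].
have inj2 : injective (@inr 'I_m1.+1 'I_m2.+1) by move=> ? ? [].
exists (f (in1 0)), (steps_of m1 (f \o in1) (fun i => phi [set in1 i; in1 i.+1])).
exists (f (in2 0)), (steps_of m2 (f \o in2) (fun i => phi [set in2 i; in2 i.+1])).
split; rewrite ?size_mkseq //.
- apply: (bpath_steps_of (g := f \o in1)).
  + by move=> i /adj1; apply: hphi.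
  + by move=> i j hi hj /injf[] /(congr1 val); rewrite /= !inordK.
  + move=> i j hi hj /(injphi _ _ _ _ (adj1 _ hi) (adj1 _ hj)) E.
    apply: (inord_step_inj hi hj); apply: (imset_inj inj1).
    by rewrite !imsetU1 !imset_set1; apply: E.
- apply: (bpath_steps_of (g := f \o in2)).
  + by move=> i /adj2; apply: hphi.
  + by move=> i j hi hj /injf[] /(congr1 val); rewrite /= !inordK.
  + move=> i j hi hj /(injphi _ _ _ _ (adj2 _ hi) (adj2 _ hj)) E.
    apply: (inord_step_inj hi hj); apply: (imset_inj inj2).
    by rewrite !imsetU1 !imset_set1; apply: E.
- move=> u; rewrite (@verts_steps_of m1 (f \o in1)) (@verts_steps_of m2 (f \o in2)).
  by case/mapP=> i _ ->; apply/negP => /mapP[j _ /= /injf].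
Qed.

Lemma contains_unionW H m1 m2 :
  contains_Berge (disjoint_union (path_graph m1) (path_graph m2)) H ->
  contains_Berge (path_graph m1) H.
Proof.
case/contains_two_pathsE=> v1 [l1 [v2 [l2 [b1 _ <- _ _]]]].
exact: contains_path b1.
Qed.

(* Deleting the middle edge of a long path leaves the two required paths. *)
Lemma contains_long_path H v l m1 m2 : bpath H v l -> m1 + m2 < size l ->
  contains_Berge (disjoint_union (path_graph m1) (path_graph m2)) H.
Proof.
move=> b lt.
have {}b : bpath H v (take (m1 + m2).+1 l) by apply: bpath_take.
have sz : size (take (m1 + m2).+1 l) = (m1 + m2).+1 by rewrite size_takel.
move: (take _ l) sz b => {lt}l sz.
have : l = take m1 l ++ drop m1 l by rewrite cat_take_drop.
have : size (take m1 l) = m1 by rewrite size_takel // sz; lia.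
have := size_drop m1 l.
move: (take m1 l) (drop m1 l) => l1 [|[e u] l2] /= s2 s1 ->; first by lia.
have -> : m1 = size l1 by lia.
have -> : m2 = size l2 by lia.
move=> b; have b1 := bpath_catl b.
have : bpath H v (rcons l1 (e, u) ++ l2) by rewrite cat_rcons.
move=> b2; have := bpath_catr b2; rewrite pend_rcons => b3.
apply: contains_two_paths b1 b3 _ _.
- move=> x xl1; case/and3P: b2 => _ uv _; move: uv.
  rewrite /verts /unzip2 map_cat map_rcons -cat_cons -rcons_cons cat_rcons cat_uniq.
  by case/and3P=> _ /hasPn h _; apply/negP => /h; rewrite /= xl1.
- move=> x xl1; case/and3P: b => _ _ uv; move: uv.
  rewrite /unzip1 map_cat /= cat_uniq => /and3P[_ /hasPn h _].
  by apply/negP => xl2; have := h x; rewrite inE xl2 orbT xl1 => /(_ isT).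
Qed.

End BergeGraphs.

(** * Degree of the end of a longest path, and the extremal example *)

(* Bounds the number of path edges through an endpoint that leave the path:
   for r = 3 an inner edge of the path through the endpoint is spanned by path
   vertices, so only the two extreme edges remain. *)
Definition kappa (r q : nat) : nat := if r == 3 then 2 else q.

(** * Binomial estimates and edge counts at the end of a path *)

Lemma leq_kappa r p q : p <= q -> kappa r p <= kappa r q.
Proof. by rewrite /kappa; case: ifP. Qed.

(** With n = k + j, Pascal's rule writes the right side as two coefficients with upper index n - 1,
    each at least C(n - 1, 2) by induction; the second one covers the increment n - 1. *)
Lemma leq_bin_mid k j : 2 <= k -> 2 <= j -> 'C(k + j, 2) <= 'C(k + j, k).
Proof.
have [n] := ubnP (k + j); elim: n k j => // n IH k j lt k2 j2.
have [->|kn2] := eqVneq k 2; first by [].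
have [->|jn2] := eqVneq j 2; first by rewrite -[X in _ <= X]bin_sub ?leq_addr // addKn.
case: k lt k2 kn2 => // k lt k2 kn2; case: j lt j2 jn2 => // j lt j2 jn2.
rewrite addSn !binS bin1.
have := IH k.+1 j; have := IH k j.+1; rewrite -addSnnS addSn.
have : k + j.+1 <= 'C(k + j.+1, 2).
  by rewrite bin2 -divn2 leq_divRL //; nia.
rewrite -addSnnS addSn; lia.
Qed.

(** The decisive numerical inequality: the difference of C(a, r-1) and C(a-1, r-1) exceeds the error
    terms of two path ends. For r = 3 it compares a - 1 with 6; for larger r, C(a-1, r-2) is at
    least C(a-1, 2), quadratic against linear. *)
Lemma binom_gap r a : 3 <= r -> r + 6 <= a ->
  2 * kappa r a.+1 + 2 < 'C(a.-1, r.-2).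
Proof.
move=> r3 ar; rewrite /kappa; case: eqP => [->|rn3].
  by rewrite bin1; lia.
have := @leq_bin_mid r.-2 (a.-1 - r.-2).
rewrite subnKC; last by lia.
rewrite bin2 => h; apply: leq_trans (h _ _); try lia.
rewrite -divn2 leq_divRL //; nia.
Qed.

Lemma binom_pred r a : 3 <= r -> r + 6 <= a ->
  'C(a, r.-1) = 'C(a.-1, r.-1) + 'C(a.-1, r.-2).
Proof. by case: a => [|a]; case: r => [|[|r]] // _ _; rewrite ?binS //; lia. Qed.

(** Raising the upper index by one adds at least one as soon as it is at least k - 1. For smaller
    [m] the first term vanishes and the count starts at k + 1. *)
Lemma bin_addl m q k N : m + q <= N -> 0 < k < N -> 'C(m, k) + q <= 'C(N, k).
Proof.
move=> mq /andP[k0 kN].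
have step i j : k.-1 <= i -> 'C(i, k) + j <= 'C(i + j, k).
  move=> ki; elim: j => [|j IH]; first by rewrite !addn0.
  rewrite addnS -(prednK k0) addnS binS prednK //.
  have : 0 < 'C(i + j, k.-1) by rewrite bin_gt0; lia.
  lia.
have [h|h] := leqP k.-1 m.
  by apply: leq_trans (step _ _ h) _; apply: leq_bin2l.
rewrite bin_small; last by lia.
have := step k.+1 (N - k.+1); rewrite binSn subnKC //; lia.
Qed.

Lemma card_edges_at (T : finType) (F : {set {set T}}) y (Z : {set T}) r :
  y \in Z -> (forall e, e \in F -> [/\ y \in e, e \subset Z & #|e| = r]) ->
  #|F| <= 'C(#|Z|.-1, r.-1).
Proof.
move=> yZ hF.
have -> : #|Z|.-1 = #|Z :\ y| by rewrite (cardsD1 y Z) yZ.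
rewrite -(cards_draws (Z :\ y) r.-1).
have <- : #|[set e :\ y | e in F]| = #|F|.
  apply: card_in_imset => e e' /hF[ye _ _] /hF[ye' _ _] E.
  by rewrite -(setD1K ye) E setD1K.
apply: subset_leq_card; apply/subsetP=> _ /imsetP[e /hF[ye eZ er] ->].
by rewrite inE setSD //= -er (cardsD1 y e) ye.
Qed.

Section EndpointDegree.
Variables (T : finType) (H : {set {set T}}) (r : nat).
Hypothesis uH : forall e, e \in H -> #|e| = r.

(** For r = 3, an edge other than the first and the last contains two path vertices joined by it and
    the end of the path; these three are distinct, so they form the whole edge. The first edge is
    excepted because the start vertex may lie outside [Z]. *)
Lemma path_edges_out v l (Z : {set T}) :
  bpath H v l -> {subset unzip2 l <= Z} ->
  #|[set e in unzip1 l | (pend v l \in e) && ~~ (e \subset Z)]| <= kappa r (size l).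
Proof.
move=> b sZ; rewrite /kappa; case: eqP => [r3|_]; last first.
  apply: leq_trans (_ : #|[set e in unzip1 l]| <= _).
    by apply: subset_leq_card; apply/subsetP => e; rewrite !inE => /and3P[].
  by rewrite cardsE -(size_map fst l); apply: card_size.
case: l b sZ => [|[e1 x1] l] b sZ.
  by rewrite (_ : [set _ in _ | _] = set0) ?cards0 //; apply/setP => e; rewrite !inE.
case/lastP: l b sZ => [|l [ep y]] b sZ.
  apply: leq_trans (_ : #|[set e1]| <= _); last by rewrite cards1.
  by apply: subset_leq_card; apply/subsetP => e; rewrite !inE => /andP[].
apply: leq_trans (_ : #|[set e1; ep]| <= _); last by rewrite cards2; case: (_ == _).
apply: subset_leq_card; apply/subsetP => e; rewrite inE.
have -> : pend v ((e1, x1) :: rcons l (ep, y)) = y by rewrite -rcons_cons pend_rcons.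
case/and3P=> ein ye nZ; apply: contraNT nZ; rewrite !inE negb_or => /andP[ne1 nep].
move: ein; rewrite /unzip1 map_cons map_rcons inE mem_rcons inE.
rewrite (negPf ne1) (negPf nep) -/(unzip1 l) => /= el.
have := @bpath_catr _ _ v [:: (e1, x1)] (rcons l (ep, y)) b.
rewrite /pend /= bpath_rcons => /and5P[b3 _ _ _ /andP[ynl _]].
have [eH [w [u [wl ul we ue wu]]]] := bpath_edge b3 el.
have wuy : [set w; u; y] \subset e.
  by apply/subsetP => z; rewrite !inE => /orP[/orP[]|] /eqP->.
have ul' : u \in verts x1 l by rewrite /verts inE ul orbT.
have yw : y != w by apply: contraNneq ynl => ->.
have yu : y != u by apply: contraNneq ynl => ->.
have E : [set w; u; y] = e.
  by apply/eqP; rewrite eqEcard wuy uH // r3 setUC cardsU1 !inE negb_or yw yu cards2 wu.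
rewrite -E; apply/subsetP => z; rewrite !inE => /orP[/orP[]|] /eqP->; apply: sZ.
- by rewrite /= /unzip2 map_rcons inE mem_rcons inE; move: wl; rewrite /verts inE => /orP[]->; rewrite ?orbT.
- by rewrite /= /unzip2 map_rcons inE mem_rcons inE -/(unzip2 l) ul !orbT.
- by rewrite /= /unzip2 map_rcons inE mem_rcons inE eqxx orbT.
Qed.

Lemma bpath_vert_edge v l u : walk H v l -> u \in unzip2 l ->
  exists2 e, e \in unzip1 l & u \in e.
Proof.
elim: l v => [|[e x] l IH] v //= /and4P[_ _ xe w].
rewrite inE => /orP[/eqP->|/(IH _ w)[e' e'l ue']]; first by exists e; rewrite ?inE ?eqxx.
by exists e'; rewrite ?inE ?e'l ?orbT.
Qed.

Lemma card_verts (v : T) (l : seq ({set T} * T)) : uniq (verts v l) -> #|[set u in verts v l]| = (size l).+1.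
Proof. by move=> u; rewrite cardsE (card_uniqP u) /= size_map. Qed.

End EndpointDegree.

(* Delete the last vertex of a longest path and induct. *)
Lemma card_path_free (T : finType) r m c (H : {set {set T}}) (W : {set T}) :
  0 < r -> 0 < m -> 'C(m.-1, r.-1) + kappa r m.-1 <= c ->
  (forall e, e \in H -> #|e| = r) -> (forall e, e \in H -> e \subset W) ->
  (forall v l, bpath H v l -> size l < m) -> #|H| <= c * #|W|.
Proof.
move=> r0 m0 hc; have [n] := ubnP #|W|; elim: n H W => // n IH H W lt uH sW nop.
have [W0|[v0 v0W]] := set_0Vmem W.
  have -> : H = set0; last by rewrite cards0.
  apply/setP => e; rewrite inE; apply/negP => eH.
  by have := sW _ eH; rewrite W0 subset0 => /eqP e0; have := uH _ eH; rewrite e0 cards0; lia.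
have [|v1 l1 [_ b1]|v [l [[vW b] mx]]] :=
    @exists_longest T (fun v l => v \in W /\ bpath H v l) m v0 [::].
- by split.
- by have := nop _ _ b1; lia.
set y := pend v l.
have yW : y \in W.
  have := pend_in v l; rewrite -/y /verts inE => /orP[/eqP->//|yl].
  have [e el ye] := bpath_vert_edge (proj1 (andP b)) yl.
  by have /subsetP := sW _ (bpath_mem_edges b el); apply.
have lt_m := nop _ _ b.
set Z := [set u in verts v l].
have cZ : #|Z| = (size l).+1 by rewrite card_verts //; case/and3P: b.
(* By maximality an edge at [y] off the path lies inside [Z]; path edges at [y] leaving [Z] are
   bounded by [kappa]. *)
have degy : #|[set e in H | y \in e]| <= c.
  apply: leq_trans hc.
  apply: leq_trans (_ : #|[set e in H | (y \in e) && (e \subset Z)]|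
     + #|[set e in unzip1 l | (pend v l \in e) && ~~ (e \subset Z)]| <= _).
    apply: leq_trans (leq_card_setU _ _).
    apply: subset_leq_card; apply/subsetP => e; rewrite !inE => /andP[eH ye].
    rewrite eH ye /=; have [//|nZ] := boolP (e \subset Z).
    rewrite /= andbT; apply/negPn/negP => nel.
    case/subsetPn: nZ => u ue; rewrite inE => un.
    have : bpath H v (rcons l (e, u)) by rewrite bpath_rcons b eH ye ue un nel.
    by move=> b'; have := mx v _ (conj vW b'); rewrite size_rcons ltnn.
  apply: leq_add.
    apply: leq_trans (card_edges_at (y := y) (Z := Z) (r := r) _ _) _.
    + by rewrite inE pend_in.
    + by move=> e; rewrite inE => /and3P[eH ye eZ]; split=> //; apply: uH.
    + by rewrite cZ /=; apply: leq_bin2l; lia.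
  apply: leq_trans (path_edges_out uH b _) _.
    by move=> u ul; rewrite inE /verts inE ul orbT.
  by apply: leq_kappa; lia.
rewrite -(cardsID [set e : {set T} | y \in e] H) (cardsD1 y W) yW mulnDr muln1.
apply: leq_add.
  by apply: leq_trans degy; rewrite setIdE.
apply: IH.
- by move: lt; rewrite (cardsD1 y W) yW; lia.
- by move=> e; rewrite inE => /andP[_]; apply: uH.
- move=> e; rewrite !inE => /andP[ye eH]; apply/subsetP => u ue; rewrite !inE.
  have /subsetP/(_ _ ue) -> := sW _ eH; rewrite andbT.
  by apply: contraNneq ye => <-.
- move=> v' l' b'; apply: (nop v'); apply: bpath_sub b'.
  exact: subsetDl.
Qed.

(** * The extremal example *)

Section LowerBound.
Variables (T : finType) (A : {set T}) (r : nat).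

Definition star_edges : {set {set T}} :=
  [set e : {set T} | (#|e| == r) && (#|e :\: A| <= 1)].

Lemma card_star_edges : 0 < r ->
  'C(#|A|, r.-1) * (#|T| - #|A|) + 'C(#|A|, r) <= #|star_edges|.
Proof.
move=> r0.
pose P := setX [set S : {set T} | (S \subset A) && (#|S| == r.-1)] (~: A).
pose f (p : {set T} * T) := p.2 |: p.1.
(* The outer vertex can be read off the edge, which makes [f] injective and separates its image from
   the edges inside [A]. *)
have fA p : p \in P -> f p :\: A = [set p.2].
  case: p => S u; rewrite inE /= !inE => /andP[/andP[SA _] uA].
  apply/setP => x; rewrite !inE; have [->|ne] := eqVneq x u; first by rewrite uA.
  by apply/negP => /andP[xA /= /(subsetP SA)]; apply/negP.
have cP : #|f @: P| = 'C(#|A|, r.-1) * (#|T| - #|A|).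
  rewrite card_in_imset; first by rewrite cardsX cards_draws (cardsCs (~: A)) setCK.
  move=> [S u] [S' u'] p p' E.
  have uu : u = u' by have := fA _ p; rewrite E fA // => /set1_inj /= ->.
  subst u'; congr pair; move: p p' E; rewrite !inE /f /=.
  move=> /andP[/andP[SA _] uA] /andP[/andP[SA' _] _] E.
  have nS (X : {set T}) : X \subset A -> (u |: X) :\ u = X.
    by move=> XA; rewrite setU1K //; apply: contra uA; apply: (subsetP XA).
  by rewrite -(nS S) // E nS.
rewrite -cP -(cards_draws A r) -cardsUI.
rewrite (_ : f @: P :&: _ = set0).
  rewrite cards0 addn0; apply: subset_leq_card; apply/subsetP => e.
  rewrite in_setU => /orP[/imsetP[[S u] p ->]|].
    rewrite inE fA // cards1 andbT; move: p; rewrite !inE /f /=.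
    move=> /andP[/andP[SA /eqP cS] uA]; rewrite cardsU1 cS.
    have -> : u \notin S by apply: contra uA; apply: (subsetP SA).
    by rewrite add1n prednK.
  by rewrite !inE -setD_eq0 => /andP[/eqP-> ->]; rewrite cards0.
apply/setP => e; rewrite !inE; apply/negP => /andP[/imsetP[p pP ->]].
by rewrite -setD_eq0 fA // => /andP[/eqP/setP/(_ p.2)]; rewrite !inE eqxx.
Qed.

(* Pair up consecutive vertices: each pair is joined by an edge with at most
   one vertex outside A. *)
Lemma count_star_path v l : bpath star_edges v l -> odd (size l) ->
  (size l).+1./2 <= count (mem A) (verts v l).
Proof.
have [n] := ubnP (size l); elim: n v l => // n IH v [|[e u] l] //= lt b od.
have vu : (v \in A) || (u \in A).
  case/and3P: b => /= /and4P[eH ve ue _]; rewrite inE negb_or => /andP[/andP[vu _] _] _.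
  apply/negPn/negP; rewrite negb_or => /andP[vA uA].
  move: eH; rewrite inE => /andP[_]; rewrite leqNgt => /negP; apply.
  have : [set v; u] \subset e :\: A.
    by apply/subsetP => x; rewrite !inE => /orP[]/eqP->; apply/andP.
  by move/subset_leq_card; rewrite cards2 vu.
case: l lt b od => [|[e' u'] l] lt b od /=.
  by case/orP: vu => ->; rewrite ?addn0 ?add0n ?leq_addl ?leq_addr //; case: (v \in A).
have b2 := @bpath_catr _ _ v [:: (e, u); (e', u')] l b.
have := IH _ _ _ b2; rewrite /pend /= => h.
have : (size l).+1./2 <= (u' \in A) + count (mem A) (unzip2 l).
  by apply: h; [move: lt => /=; lia | move: od => /=; rewrite negbK].
by case/orP: vu => ->; lia.
Qed.

(** The two paths use (m1+1)/2 and (m2+1)/2 vertices of [A], all distinct; by oddness these add up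
    to (m1+m2)/2 + 1. *)
Lemma star_edges_free m1 m2 : odd m1 -> odd m2 -> #|A| < (m1 + m2)./2.+1 ->
  ~~ contains_Berge (disjoint_union (path_graph m1) (path_graph m2)) star_edges.
Proof.
move=> o1 o2; apply: contraL => /contains_two_pathsE[v1 [l1 [v2 [l2 [b1 b2 s1 s2 dv]]]]].
rewrite -leqNgt.
have := count_star_path b1; have := count_star_path b2; rewrite s1 s2 => /(_ o2) h2 /(_ o1) h1.
apply: leq_trans (_ : count (mem A) (verts v1 l1 ++ verts v2 l2) <= _).
  by rewrite count_cat; lia.
rewrite -size_filter cardE; apply: uniq_leq_size.
  apply: filter_uniq; rewrite cat_uniq.
  case/and3P: b1 => _ -> _; case/and3P: b2 => _ -> _; rewrite andTb andbT.
  by apply/hasPn => u u2; apply/negP => /= u1; have := dv _ u1; rewrite u2.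
by move=> u; rewrite mem_filter mem_enum => /andP[].
Qed.

End LowerBound.

(** * Connectivity in the 2-shadow *)

(** Besides the step that leaves [P], its far end is known to be connected to [k], which later
    places it in a given component. *)
Lemma connect_exit (T : finType) (R : rel T) (P : pred T) k x :
  connect R k x -> P k -> ~~ P x ->
  exists u u', [/\ P u, ~~ P u', R u u' & connect R k u'].
Proof.
case/connectP=> p pp ->; elim: p k pp => [|z p IH] k /=.
  by move=> _ ->.
case/andP=> kz pz Pk nP; have [Pz|nPz] := boolP (P z).
  have [u [u' [h1 h2 h3 h4]]] := IH _ pz Pz nP.
  by exists u, u'; split=> //; apply: connect_trans h4; apply: connect1.
by exists k, z; split=> //; apply: connect1.
Qed.

Section Shadow.
Variables (T : finType) (H : {set {set T}}).
Implicit Types (A W S K X Y D : {set T}).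

Definition adj : rel T := fun x y => [exists e in H, (x \in e) && (y \in e)].

Lemma adjI e x y : e \in H -> x \in e -> y \in e -> adj x y.
Proof. by move=> eH xe ye; apply/exists_inP; exists e; rewrite ?xe. Qed.

Lemma adjP x y : reflect (exists e, [/\ e \in H, x \in e & y \in e]) (adj x y).
Proof.
apply: (iffP exists_inP) => [[e eH /andP[xe ye]]|[e [eH xe ye]]]; exists e => //.
by rewrite xe.
Qed.

Lemma adj_sym x y : adj x y = adj y x.
Proof. by apply/adjP/adjP => -[e [eH h1 h2]]; exists e. Qed.

(** The 2-shadow of [H] is induced on [A]: the hyperedge joining two vertices of [A] may itself
    leave [A]. *)
Definition cadj A : rel T := fun x y => [&& x \in A, y \in A & adj x y].

Lemma cadj_connect_sym A : connect_sym (cadj A).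
Proof.
by apply: sym_connect_sym => x y; rewrite /cadj adj_sym; case: (x \in A); case: (y \in A).
Qed.

Definition conn A := forall x y, x \in A -> y \in A -> connect (cadj A) x y.

Definition comp A x : {set T} := [set y in A | connect (cadj A) x y].
Definition comps A : {set {set T}} := [set comp A x | x in A].

Lemma comps_comp A x : x \in A -> comp A x \in comps A.
Proof. exact: imset_f. Qed.

Lemma mem_comp A x : x \in A -> x \in comp A x.
Proof. by move=> xA; rewrite inE xA connect0. Qed.

Lemma comps_sub A X : X \in comps A -> X \subset A.
Proof. by case/imsetP=> x _ ->; apply/subsetP => y; rewrite inE => /andP[]. Qed.

Lemma comps_connect A X x y : X \in comps A -> x \in X -> y \in X ->
  connect (cadj A) x y.
Proof.
case/imsetP=> z _ ->; rewrite !inE => /andP[_ zx] /andP[_ zy].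
by apply: connect_trans zy; rewrite cadj_connect_sym.
Qed.

Lemma comps_closure A X x y : X \in comps A -> x \in X -> y \in A ->
  connect (cadj A) x y -> y \in X.
Proof.
case/imsetP=> z _ ->; rewrite !inE => /andP[_ zx] -> xy /=.
exact: connect_trans xy.
Qed.

Lemma comps_closed A X x y : X \in comps A -> x \in X -> y \in A -> adj x y ->
  y \in X.
Proof.
move=> XA xX yA xy; apply: (comps_closure XA xX yA); apply: connect1.
by rewrite /cadj xy yA (subsetP (comps_sub XA)).
Qed.

Lemma comps_eq A X Y x : X \in comps A -> Y \in comps A -> x \in X -> x \in Y ->
  X = Y.
Proof.
move=> XA YA xX xY; apply/eqP; rewrite eqEsubset; apply/andP; split;
  apply/subsetP => z zX.
- apply: (comps_closure YA xY); first by apply: (subsetP (comps_sub XA)).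
  exact: comps_connect XA xX zX.
- apply: (comps_closure XA xX); first by apply: (subsetP (comps_sub YA)).
  exact: comps_connect YA xY zX.
Qed.

Lemma comps_neq0 A X : X \in comps A -> exists x, x \in X.
Proof. by case/imsetP=> x xA ->; exists x; apply: mem_comp. Qed.

Lemma conn_comps W x : conn W -> x \in W -> W \in comps W.
Proof.
move=> cW xW; have E : comp W x = W; last by rewrite -{1}E comps_comp.
apply/setP => y; rewrite inE.
by case: (boolP (y \in W)) => //= yW; rewrite cW.
Qed.

Lemma walk_connect A v l u : walk H v l -> {subset verts v l <= A} ->
  u \in verts v l -> connect (cadj A) v u.
Proof.
elim: l v => [|[e x] l IH] v /=.
  by move=> _ _; rewrite inE => /eqP ->; apply: connect0.
case/and4P=> eH ve xe w sA; rewrite inE => /orP[/eqP->|ul]; first exact: connect0.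
apply: connect_trans (IH x w _ ul); last by move=> z zl; apply: sA; rewrite inE zl orbT.
apply: connect1; rewrite /cadj (adjI eH ve xe) !sA // !inE eqxx ?orbT //.
Qed.

Lemma conn_setD W Y K0 k0 : conn W -> K0 \subset W :\: Y -> k0 \in K0 ->
  (forall k, k \in K0 -> connect (cadj (W :\: Y)) k k0) ->
  (forall y u, y \in Y -> u \in W :\: Y -> adj y u ->
     exists2 k, k \in K0 & (u == k) || adj u k) ->
  conn (W :\: Y).
Proof.
move=> cW sK k0K hK hY.
have to0 u : u \in W :\: Y -> connect (cadj (W :\: Y)) u k0.
  move=> uW; apply/negPn/negP => nc.
  have uW' : u \in W by move: uW; rewrite inE => /andP[].
  have k0W : k0 \in W by have := subsetP sK _ k0K; rewrite inE => /andP[].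
  have [||x [x' [xP x'P /and3P[xW x'W xx'] _]]] :=
    connect_exit (P := mem (comp (W :\: Y) u)) (cW _ _ uW' k0W).
  - exact: mem_comp.
  - by rewrite /= inE negb_and nc orbT.
  have xWY : x \in W :\: Y by move: xP; rewrite /= inE => /andP[].
  have ux : connect (cadj (W :\: Y)) u x by move: xP; rewrite /= inE => /andP[].
  have x'Y : x' \in Y.
    apply: contraNT x'P => nY /=; apply: (comps_closed (comps_comp uW) xP _ xx').
    by rewrite inE nY.
  have [|k kK xk] := hY x' x x'Y xWY; first by rewrite adj_sym.
  have kW := subsetP sK _ kK.
  case/negP: nc; apply: connect_trans (hK _ kK).
  apply: connect_trans ux _; case/orP: xk => [/eqP->|xk]; first exact: connect0.
  by apply: connect1; rewrite /cadj xWY kW.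
move=> x y xW yW; apply: connect_trans (to0 _ xW) _.
by rewrite cadj_connect_sym; apply: to0.
Qed.

(** [K] is too large to be covered by [D] and at most [L] components of size at most [m], so some
    large component meets [K]. Walking inside [K] from it towards [x], the first vertex outside it
    lies in [D]. *)
Lemma pick_comp W S K D x m L : K \in comps (W :\: S) -> x \in D -> x \in K ->
  #|comps (W :\: (S :|: D))| <= L -> L * m + #|D| < #|K| ->
  exists K' x' k', [/\ K' \in comps (W :\: (S :|: D)), m < #|K'|,
     x' \in D :&: K, k' \in K' & adj x' k'].
Proof.
set W' := W :\: (S :|: D) => Kc xD xK cL big.
have [/exists_inP[K' K'c /andP[mK' /exists_inP[k kK' kK]]]|] :=
  boolP [exists K' in comps W', (m < #|K'|) && [exists k in K', k \in K]].
  have xn : x \notin K'.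
    apply/negP => /(subsetP (comps_sub K'c)).
    by rewrite !inE xD orbT.
  have [u [u' [uK' u'K' /and3P[uW u'W uu'] ku']]] :=
    connect_exit (P := mem K') (comps_connect Kc kK xK) kK' xn.
  have u'K := comps_closure Kc kK u'W ku'.
  exists K', u', u; split=> //; last by rewrite adj_sym.
  rewrite inE u'K andbT; apply: contraNT u'K' => u'D /=.
  apply: (comps_closed K'c uK' _ uu').
  by move: u'W; rewrite !inE negb_or u'D => /andP[-> ->].
rewrite negb_exists => /forallP small.
suff : #|K| <= L * m + #|D| by lia.
apply: leq_trans (_ : #|cover [set X in comps W' | #|X| <= m] :|: D| <= _).
  apply: subset_leq_card; apply/subsetP => k kK; rewrite inE.
  have [kD|kD] := boolP (k \in D); first by rewrite orbT.
  have kW' : k \in W'.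
    by have := subsetP (comps_sub Kc) _ kK; rewrite !inE (negPf kD) orbF.
  rewrite orbF; apply/bigcupP; exists (comp W' k); last exact: mem_comp.
  rewrite inE comps_comp //=.
  have := small (comp W' k); rewrite comps_comp //= negb_and -leqNgt.
  by case/orP=> // /existsP[]; exists k; rewrite mem_comp // kK.
apply: leq_trans (leq_card_setU _ _) _; rewrite leq_add2r.
apply: leq_trans (leq_card_cover _) _.
apply: leq_trans (_ : \sum_(X in [set X in comps W' | #|X| <= m]) m <= _).
  by apply: leq_sum => X; rewrite inE => /andP[].
rewrite sum_nat_const; apply: leq_mul => //; apply: leq_trans cL.
by apply: subset_leq_card; apply/subsetP => X; rewrite inE => /andP[].
Qed.

End Shadow.

(** * Bounded path length forces a small set that leaves many components *)

Section ManyComponents.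
Variables (T : finType) (H : {set {set T}}) (r : nat).
Hypothesis uH : forall e, e \in H -> #|e| = r.
Variables (W : {set T}) (L : nat).

(** Component size that guarantees [t] further steps: each step deletes an edge of [r'] vertices and
    passes to one of at most [L'] components. *)
Fixpoint comp_bound (L' r' t : nat) : nat :=
  if t is t'.+1 then L' * comp_bound L' r' t' + r' else 0.

(* Grow a Berge path into the largest component that remains after deleting
   all edges used so far; it can only stop by creating many components. *)
Lemma grow_path t (S K : {set T}) v0 l :
  bpath H v0 l -> {subset verts v0 l <= S} ->
  (forall e, e \in unzip1 l -> e \subset S) -> K \in comps H (W :\: S) ->
  (exists2 k, k \in K & adj H (pend v0 l) k) -> comp_bound L r t < #|K| ->
  (exists S' : {set T}, #|S'| <= #|S| + r * t /\ L <= #|comps H (W :\: S')|)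
  \/ (exists l', bpath H v0 l' /\ size l' = size l + t).
Proof.
elim: t S K l => [|t IH] S K l b sS eS Kc [k kK vk] big.
  by right; exists l; rewrite addn0.
case/adjP: vk => e [eH ve ke].
have [hL|hL] := leqP L #|comps H (W :\: (S :|: e))|.
  left; exists (S :|: e); split=> //.
  by apply: leq_trans (leq_card_setU _ _) _; rewrite (uH eH) mulnS; lia.
have [|K' [x' [k' [K'c mK' /setIP[x'e x'K] k'K' xk]]]] :=
  pick_comp (m := comp_bound L r t) Kc ke kK (ltnW hL).
  by rewrite (uH eH).
have KS z : z \in K -> z \notin S.
  by move/(subsetP (comps_sub Kc)); rewrite inE => /andP[].
have b' : bpath H v0 (rcons l (e, x')).
  rewrite bpath_rcons b eH ve x'e /=; apply/andP; split.
    by apply: contra (KS _ x'K); apply: sS.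
  apply/negP => /eS /subsetP /(_ _ ke); apply/negP; exact: KS.
have [| | |[S' [h1 h2]]|[l' [b'' s'']]] := IH (S :|: e) K' _ b' _ _ K'c _ mK'.
- move=> u; rewrite verts_rcons mem_rcons inE in_setU => /orP[/eqP->|/sS->//].
  by rewrite x'e orbT.
- move=> f; rewrite /unzip1 map_rcons mem_rcons inE => /orP[/eqP->|/eS fS].
    exact: subsetUr.
  exact: subset_trans fS (subsetUl _ _).
- by exists k' => //; rewrite pend_rcons.
- left; exists S'; split=> //; apply: leq_trans h1 _.
  by rewrite mulnS addnA leq_add2r -(uH eH); case: (leq_card_setU S e).
- by right; exists l'; split=> //; rewrite s'' size_rcons addSnnS.
Qed.

Lemma many_comps m : conn H W -> (forall v l, bpath H v l -> size l < m) ->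
  L * comp_bound L r m + 1 < #|W| ->
  exists S : {set T}, #|S| <= 1 + r * m /\ L <= #|comps H (W :\: S)|.
Proof.
move=> cW nop big.
have [v0 v0W] : exists v, v \in W by apply/card_gt0P; lia.
have [hL|hL] := leqP L #|comps H (W :\: [set v0])|.
  by exists [set v0]; rewrite cards1.
have WC : W \in comps H (W :\: set0) by rewrite setD0; apply: conn_comps v0W.
(* Deleting [v0] alone from [W] starts the growth; the vertex [x'] is then [v0] itself. *)
have [| | |K' [x' [k' [K'c mK' x'I k'K' xk]]]] :=
  @pick_comp T H W set0 W [set v0] v0 (comp_bound L r m) L WC _ v0W.
- by rewrite inE.
- by rewrite set0U ltnW.
- by rewrite cards1.
move: x'I; rewrite !inE => /andP[/eqP x'v _]; subst x'.
rewrite set0U in K'c.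
have [| | |[S' [h1 h2]]|[l' [b' s']]] := @grow_path m [set v0] K' v0 [::] isT _ _ K'c _ mK'.
- by move=> u; rewrite inE => /eqP ->; rewrite inE.
- by [].
- by exists k'.
- by exists S'; rewrite cards1 in h1.
- by have := nop _ _ b'; rewrite s' ltnn.
Qed.

End ManyComponents.

(** * Weaving paths through many similar components *)

Section Link.
Variables (T : finType) (S : {set T}) (F : {set {set T}}).

Definition heavy : {set T} := [set t in S | 1 < #|[set f in F | t \in f]|].

(* Any two vertices of B are covered by two different edges of F; the vertices
   of S covered only once contribute one representative per edge. *)
Record link_set (B : {set T}) : Prop := LinkSet {
  link_heavy : heavy \subset B;
  link_sub : B \subset S;
  link_cover : forall t, t \in B -> exists2 f, f \in F & t \in f;
  link_pair : forall t t', t \in B -> t' \in B -> t != t' ->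
    exists f f', [/\ f \in F, f' \in F, t \in f, t' \in f' & f != f'];
  link_count : #|[set f in F | ~~ (f :&: S \subset heavy)]| + #|heavy| <= #|B| }.

Lemma heavy_other t g : t \in heavy -> exists f, [/\ f \in F, t \in f & f != g].
Proof.
rewrite inE => /andP[_ ct].
have : 0 < #|[set f in F | t \in f] :\ g|.
  by rewrite (cardsD1 g) in ct; case: (g \in _) ct; lia.
by case/card_gt0P=> f; rewrite !inE => /and3P[fg fF tf]; exists f.
Qed.

(** Add to the heavy vertices one non-heavy vertex of [S] from every edge that has one. A non-heavy
    vertex lies in at most one edge, so the representatives are distinct and two of them come from
    different edges. *)
Lemma exists_link_set : exists B, link_set B.
Proof.
pose F1 := [set f in F | ~~ (f :&: S \subset heavy)].
pose pf (f : {set T}) := [pick t in (f :&: S) :\: heavy].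
pose R1 := [set t | Some t \in pf @: F1].
have pfP f : f \in F1 -> exists t, [/\ pf f = Some t, t \in f, t \in S & t \notin heavy].
  rewrite inE => /andP[_ /subsetPn[t tfS th]]; rewrite /pf; case: pickP.
    by move=> t'; rewrite in_setD in_setI => /and3P[h1 h2 h3]; exists t'.
  by move/(_ t); rewrite in_setD tfS th.
have R1P t : t \in R1 -> exists f, [/\ f \in F1, pf f = Some t, t \in f & t \in S].
  rewrite inE => /imsetP[f fF1 E]; have [t' [pt tf tS _]] := pfP _ fF1.
  by exists f; move: E; rewrite pt => -[->].
have F1F f : f \in F1 -> f \in F by rewrite inE => /andP[].
have cR1 : #|F1| <= #|R1|.
  have Sinj : injective (@Some T) by move=> ? ? [].
  rewrite -(card_imset R1 Sinj) -(card_in_imset (f := pf) (D := F1)).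
    apply: subset_leq_card; apply/subsetP => _ /imsetP[f fF1 ->].
    have [t [pt _ _ _]] := pfP _ fF1; rewrite pt; apply: imset_f.
    by rewrite inE -pt imset_f.
  move=> f f' fF1 fF1'; have [t [pt tf tS th]] := pfP _ fF1.
  have [t' [pt' tf' _ _]] := pfP _ fF1'; rewrite pt pt' => -[tt]; subst t'.
  apply/eqP/negPn/negP => ne; case/negP: th; rewrite inE tS /=.
  apply: leq_trans (_ : #|[set f; f']| <= _); first by rewrite cards2 ne.
  apply: subset_leq_card; apply/subsetP => g; rewrite !inE => /orP[]/eqP->.
    by rewrite F1F.
  by rewrite F1F.
exists (heavy :|: R1); split.
- exact: subsetUl.
- apply/subsetP => t; rewrite in_setU => /orP[|/R1P[f []//]].
  by rewrite inE => /andP[].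
- move=> t; rewrite in_setU => /orP[/(@heavy_other t set0)[f []]|/R1P[f [/F1F]]];
    by exists f.
- have cov t : t \in heavy :|: R1 -> exists2 f, f \in F & t \in f.
    rewrite in_setU => /orP[/(@heavy_other t set0)[f []]|/R1P[f [/F1F]]];
    by exists f.
  move=> t t' tB t'B ne.
  have [f fF tf] := cov _ tB; have [f' fF' tf'] := cov _ t'B.
  have [th|th] := boolP (t \in heavy).
    by have [g [gF tg gf]] := heavy_other f' th; exists g, f'.
  have [th'|th'] := boolP (t' \in heavy).
    by have [g [gF tg gf]] := heavy_other f th'; exists f, g; rewrite eq_sym.
  move: tB t'B; rewrite !in_setU (negPf th) (negPf th') /=.
  move=> /R1P[g [gF pg tg _]] /R1P[g' [gF' pg' tg' _]].
  exists g, g'; split=> //; try exact: F1F.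
  by apply: contraNneq ne => E; move: pg; rewrite E pg' => -[->].
- rewrite cardsU (_ : heavy :&: R1 = set0) ?cards0 ?subn0; first by rewrite addnC leq_add2l.
  apply/setP => t; rewrite !inE; apply/negP => /andP[ht].
  case/imsetP=> f /pfP[t' [-> _ _ h]] [E]; subst t'.
  by case/negP: h; rewrite inE.
Qed.

End Link.

(** * Concatenation of paths through distinct components *)

Section Weaving.
Variables (T : finType) (H : {set {set T}}) (W S : {set T}).

Implicit Types (X : {set T}).
Local Notation CC := (comps H (W :\: S)).

Lemma comp_disj X x : X \in CC -> x \in X -> x \notin S.
Proof. by move=> /comps_sub/subsetP h /h; rewrite inE => /andP[]. Qed.

Lemma touch_eq X X' e x x' : X \in CC -> X' \in CC -> e \in H ->
  x \in X -> x \in e -> x' \in X' -> x' \in e -> X = X'.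
Proof.
move=> XC XC' eH xX xe xX' xe'; apply: (comps_eq XC XC' _ xX').
apply: (comps_closed XC xX); first exact: (subsetP (comps_sub XC')).
exact: adjI eH xe xe'.
Qed.

(** Only the vertices after the start are required to lie in [X]; in the applications [t] is a
    vertex of [S]. *)
Definition arm (X : {set T}) t l q := [/\ bpath H t l, {subset unzip2 l <= X} & size l = q].

Lemma bpath_cons v e u l : bpath H v ((e, u) :: l) =
  [&& e \in H, v \in e, u \in e, v \notin verts u l, e \notin unzip1 l & bpath H u l].
Proof.
rewrite /bpath /=; apply/idP/idP.
- by case/and3P=> /and4P[-> -> -> ->] /and3P[-> -> ->] /andP[-> ->].
- by case/and5P=> -> -> -> -> /andP[-> /and3P[-> /= /andP[-> ->] ->]].
Qed.

Record woven (Xs : seq {set T}) (ts : seq T) v l : Prop := Woven {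
  wv_path : bpath H v l;
  wv_vert : forall u, u \in verts v l -> u \in ts \/ exists2 X, X \in Xs & u \in X;
  wv_edge : forall e, e \in unzip1 l ->
    exists2 X, X \in Xs & exists2 x, x \in X & x \in e }.

(** No hyperedge meets two components of [W :\: S]. Every edge of the woven path meets a component
    of [Xs] and every new edge meets the fresh [X], so no edge is repeated. *)
Lemma woven_append Xs ts v l X l2 :
  {subset Xs <= CC} -> {subset ts <= S} -> X \in CC -> X \notin Xs ->
  woven Xs ts v l -> bpath H (pend v l) l2 ->
  (forall u, u \in unzip2 l2 -> u \in X \/ (u \in S /\ u \notin ts)) ->
  (forall e, e \in unzip1 l2 -> exists2 x, x \in X & x \in e) ->
  bpath H v (l ++ l2).
Proof.
move=> XsC tsS XC nX [b wv we] b2 v2 e2; apply: bpath_cat => //.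
- move=> u ul2; apply/negP => /wv[uts|[X' X'in uX']].
    case: (v2 _ ul2) => [uX|[_ /negP]]; last by apply.
    by have := comp_disj XC uX; rewrite tsS.
  case: (v2 _ ul2) => [uX|[uS _]].
    by case/negP: nX; rewrite (comps_eq XC (XsC _ X'in) uX uX').
  by have := comp_disj (XsC _ X'in) uX'; rewrite uS.
- move=> e el2; apply/negP => el; have [X' X'in [x' x'X' x'e]] := we _ el.
  have [x xX xe] := e2 _ el2.
  have eH := bpath_mem_edges b el.
  by case/negP: nX; rewrite (touch_eq XC (XsC _ X'in) eH xX xe x'X' x'e).
Qed.

Lemma arm_edge X t l q e : arm X t l q -> e \in unzip1 l -> exists2 x, x \in X & x \in e.
Proof.
case=> b sX _ el; have [_ [w [u [_ ul _ ue _]]]] := bpath_edge b el.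
by exists u => //; apply: sX.
Qed.

Lemma woven_start X t l q : arm X t l q ->
  exists v l', [/\ woven [:: X] [:: t] v l', pend v l' = t & size l' = q].
Proof.
move=> ar; have [b sX sz] := ar.
have [l' [b' p' s' v' e']] := bpath_rev b.
exists (pend t l), l'; split=> //; last by rewrite s'.
split=> //.
- move=> u; rewrite v' mem_rev inE => /orP[/eqP->|ul].
    by left; rewrite inE.
  by right; exists X; rewrite ?inE //; apply: sX.
- move=> e; rewrite e' mem_rev => /(arm_edge ar) h.
  by exists X; rewrite ?inE.
Qed.

Lemma woven_cross Xs ts v l X t' l2 e :
  {subset Xs <= CC} -> {subset ts <= S} -> X \in CC -> X \notin Xs ->
  t' \in S -> t' \notin ts -> 0 < size l2 ->
  woven Xs ts v l -> {subset unzip2 l2 <= X} ->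
  bpath H (pend v l) (rcons l2 (e, t')) ->
  woven (X :: Xs) (t' :: ts) v (l ++ rcons l2 (e, t')).
Proof.
move=> XsC tsS XC nX t'S t'n sz wv sX b2.
have [b2' eH pe _ /andP[_ _]] := and5P (etrans (esym (bpath_rcons _ _ _ _ _)) b2).
have e2X f : f \in unzip1 (rcons l2 (e, t')) -> exists2 x, x \in X & x \in f.
  rewrite /unzip1 map_rcons mem_rcons inE => /orP[/eqP->|]; last first.
    by apply: (@arm_edge X (pend v l) l2 (size l2)).
  exists (pend (pend v l) l2) => //; apply: sX; rewrite /pend.
  by case: (l2) sz => //= -[f' u'] l2' _; apply: mem_last.
have v2X u : u \in unzip2 (rcons l2 (e, t')) -> u = t' \/ u \in X.
  rewrite /unzip2 map_rcons mem_rcons inE => /orP[/eqP->|ul]; first by left.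
  by right; apply: sX.
split.
- apply: (@woven_append Xs ts v l X) => //.
  by move=> u /v2X[->|]; [right|left].
- move=> u; rewrite /verts /unzip2 map_cat -cat_cons mem_cat => /orP[/(wv_vert wv)|/v2X].
    case=> [uts|[X' X'in uX']]; first by left; rewrite inE uts orbT.
    by right; exists X'; rewrite ?inE ?X'in ?orbT.
  case=> [->|uX]; first by left; rewrite inE eqxx.
  by right; exists X; rewrite ?inE ?eqxx.
- move=> f; rewrite /unzip1 map_cat mem_cat => /orP[/(wv_edge wv)[X' X'in h]|/e2X h].
    by exists X'; rewrite ?inE ?X'in ?orbT.
  by exists X; rewrite ?inE ?eqxx.
Qed.

Lemma woven_end Xs ts v l X l2 q :
  {subset Xs <= CC} -> {subset ts <= S} -> X \in CC -> X \notin Xs ->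
  woven Xs ts v l -> arm X (pend v l) l2 q -> bpath H v (l ++ l2).
Proof.
move=> XsC tsS XC nX wv ar; have [b2 sX _] := ar.
apply: (@woven_append Xs ts v l X) => //.
  by move=> u /sX uX; left.
by move=> e; apply: arm_edge ar.
Qed.

End Weaving.

(** * Longest arms of the components, classified by type *)

Section Copies.
Variables (T : finType) (H : {set {set T}}) (W S : {set T}).

Implicit Types (X : {set T}).
Local Notation CC := (comps H (W :\: S)).

Definition free_edges s l : {set {set T}} :=
  [set f in H | [&& pend s l \in f, f \subset W & f \notin unzip1 l]].

Record copy X s p (Nb B : {set T}) l : Prop := Copy {
  cp_comp : X \in CC;
  cp_s : s \in S;
  cp_sW : s \in W;
  cp_arm : arm H X s l p;
  cp_pos : 0 < p;
  cp_max : forall l' q, arm H X s l' q -> q <= p;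
  cp_nb : Nb = [set t in S | adj H (pend s l) t];
  cp_link : link_set S (free_edges s l) B }.

Lemma exists_copy X N : conn H W -> 1 < #|CC| -> X \in CC ->
  (forall v l, bpath H v l -> size l <= N) ->
  exists s p Nb B l, copy X s p Nb B l.
Proof.
move=> cW c2 XC nop.
have [X' X'C ne] : exists2 X', X' \in CC & X' != X.
  rewrite (cardsD1 X) XC in c2.
  have /card_gt0P[X'] : 0 < #|CC :\ X| by move: c2; rewrite add1n ltnS.
  by rewrite !inE => /andP[h1 h2]; exists X'.
have [x xX] := comps_neq0 XC; have [x' xX'] := comps_neq0 X'C.
have inW Y z : Y \in CC -> z \in Y -> z \in W.
  by move=> /comps_sub/subsetP h /h; rewrite inE => /andP[].
have [||u [s [uX sX /and3P[uW sW us] _]]] :=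
    connect_exit (P := mem X) (cW _ _ (inW _ _ XC xX) (inW _ _ X'C xX')).
- exact: xX.
- by apply/negP => x'X; case/negP: ne; apply/eqP; apply: comps_eq X'C XC xX' x'X.
have sS : s \in S.
  apply: contraNT sX => nS /=; apply: (comps_closed XC uX _ us).
  by rewrite inE nS.
have [e [eH ue se]] := adjP _ _ _ us.
have su : s != u by apply: contraNneq sX => ->.
have a0 : arm H X s [:: (e, u)] 1.
  split=> //; last by move=> z; rewrite inE => /eqP ->.
  by rewrite bpath_cons /= eH se ue !inE su.
have [|v l [_ [q [b _ _]]]|v [l [[_ [p ar]] mx]]] :=
  @exists_longest T (fun v l => v = s /\ exists q, arm H X s l q) N s [:: (e, u)].
- by split=> //; exists 1.
- exact: nop b.
have szp : size l = p by case: ar.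
have [B lB] := exists_link_set S (free_edges s l).
exists s, p, [set t in S | adj H (pend s l) t], B, l; split=> //.
- rewrite -szp; apply: leq_trans (mx s _ (conj erefl (ex_intro _ 1 a0))).
  by [].
- move=> l' q ar'; have := mx s l' (conj erefl (ex_intro _ q ar')).
  by rewrite szp; case: ar' => _ _ ->.
Qed.

Section OneCopy.
Variables (X : {set T}) (s : T) (p : nat) (Nb B : {set T}) (l : seq ({set T} * T)).
Hypothesis cp : copy X s p Nb B l.

Let y := pend s l.

Lemma cp_bpath : bpath H s l. Proof. by case: (cp_arm cp). Qed.
Lemma cp_subX : {subset unzip2 l <= X}. Proof. by case: (cp_arm cp). Qed.
Lemma cp_size : size l = p. Proof. by case: (cp_arm cp). Qed.

Lemma copy_sX : s \notin X.
Proof. by apply/negP => /(comp_disj (cp_comp cp)); rewrite (cp_s cp). Qed.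

Lemma copy_end_unzip : y \in unzip2 l.
Proof.
have := cp_pos cp; rewrite -cp_size /y /pend; case: (l) => [|[e u] l'] //= _.
exact: mem_last.
Qed.

Lemma copy_end_in : y \in X.
Proof. exact: cp_subX copy_end_unzip. Qed.

(* Otherwise the path could be extended. *)
Lemma copy_free_vert f u : f \in H -> y \in f -> f \notin unzip1 l ->
  u \in f -> u \in W -> u \in S \/ u \in unzip2 l.
Proof.
move=> fH yf fl uf uW; have [uS|uS] := boolP (u \in S); [by left | right].
have uX : u \in X.
  apply: (comps_closed (cp_comp cp) copy_end_in); first by rewrite inE uS.
  exact: adjI fH yf uf.
apply/negPn/negP => ul.
have us : u != s by apply: contraNneq uS => ->; exact: cp_s cp.
have : arm H X s (rcons l (f, u)) p.+1.
  split; last by rewrite size_rcons cp_size.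
    by rewrite bpath_rcons cp_bpath fH yf uf fl /verts inE negb_or us ul.
  move=> z; rewrite /unzip2 map_rcons mem_rcons inE => /orP[/eqP->//|].
  exact: cp_subX.
by move/(cp_max cp); rewrite ltnn.
Qed.

(** Enter at the end [y] through [f] and follow the path backwards to its first vertex, which gives
    [p] edges again. The old first edge [e1] stays free and leads back to [s]; for [t = s] this is a
    rotation of the path. *)
Lemma copy_arm_from t f : t \in S -> f \in H -> y \in f -> f \notin unzip1 l -> t \in f ->
  exists l' e1, [/\ arm H X t l' p, e1 \in H, pend t l' \in e1, s \in e1
    & [/\ e1 \notin unzip1 l', ohead (unzip2 l) = Some (pend t l'), {subset unzip1 l' <= f :: unzip1 l}
        & {subset unzip2 l' <= unzip2 l}]].
Proof.
move=> tS fH yf fl tf.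
have yX := copy_end_in; have := cp_bpath; have := cp_subX; have := cp_size; have := cp_pos cp.
move: fl; rewrite /y in yf yX *; case: (l) yf yX => [|[e1 x1] l0].
  by move=> _ _ _ p0 /= E; move: p0; rewrite -E.
rewrite /= -[pend s _]/(pend x1 l0) => yf yX fl p0 sz sX.
rewrite bpath_cons => /and5P[e1H se1 x1e1 _ /andP[e1l b0]].
have [l' [b' p' s' v' e']] := bpath_rev b0.
have vX u : u \in verts (pend x1 l0) l' -> u \in x1 :: unzip2 l0 by rewrite v' mem_rev.
exists ((f, pend x1 l0) :: l'), e1; rewrite -[pend t _]/(pend (pend x1 l0) l') p'.
move: fl; rewrite inE negb_or => /andP[fe1 fl0].
split=> //.
- split; last by rewrite /= s' -sz.
    rewrite bpath_cons fH tf yf b' e' mem_rev fl0 /= andbT.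
    apply/negP => /vX /sX /(comp_disj (cp_comp cp)).
    by rewrite tS.
  by move=> u; rewrite /= => /vX /sX.
- split.
  + by rewrite /= inE e' mem_rev negb_or eq_sym fe1.
  + by [].
  + by move=> g; rewrite /= e' !inE mem_rev => /orP[] ->; rewrite ?orbT.
  + by move=> u /= /vX.
Qed.

Lemma free_edgesP f : f \in free_edges s l ->
  [/\ f \in H, y \in f, f \subset W & f \notin unzip1 l].
Proof. by rewrite inE => /and4P[]. Qed.

Lemma copy_arm t : t \in B -> exists l', arm H X t l' p.
Proof.
move=> tB; have [f /free_edgesP[fH yf _ fl] tf] := link_cover (cp_link cp) tB.
have tS := subsetP (link_sub (cp_link cp)) _ tB.
by have [l' [e1 []]] := copy_arm_from tS fH yf fl tf; exists l'.
Qed.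

Lemma copy_cross_s t : t \in B -> t != s ->
  exists l' e1, [/\ size l' = p, {subset unzip2 l' <= X} & bpath H t (rcons l' (e1, s))].
Proof.
move=> tB ts; have [f /free_edgesP[fH yf _ fl] tf] := link_cover (cp_link cp) tB.
have tS := subsetP (link_sub (cp_link cp)) _ tB.
have [l' [e1 [[b sX sz] e1H pe se [e1l _ _ _]]]] := copy_arm_from tS fH yf fl tf.
exists l', e1; split=> //; rewrite bpath_rcons b e1H pe se e1l andbT /=.
rewrite /verts inE negb_or eq_sym ts /=; apply/negP => /sX.
by apply/negP; apply: copy_sX.
Qed.

(** Two different free edges at the end [y] give a crossing with two edges. *)
Lemma copy_cross t t' : t \in B -> t' \in B -> t != t' ->
  exists l' e, [/\ size l' = 1, {subset unzip2 l' <= X} & bpath H t (rcons l' (e, t'))].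
Proof.
move=> tB tB' ne.
have [f [f' [/free_edgesP[fH yf _ _] /free_edgesP[fH' yf' _ _] tf tf' ff]]] :=
  link_pair (cp_link cp) tB tB' ne.
have nX z : z \in B -> z != y.
  move=> zB; apply/eqP => E; have := comp_disj (cp_comp cp) copy_end_in.
  by rewrite -/y -E (subsetP (link_sub (cp_link cp))).
exists [:: (f, y)], f'; split=> //.
  by move=> u; rewrite inE => /eqP ->; exact: copy_end_in.
rewrite /= !bpath_cons fH tf yf fH' yf' tf' /= !inE !negb_or nX // ne ff.
by rewrite eq_sym nX.
Qed.

End OneCopy.

(** * Long paths through many copies of one type *)

Section ManyCopies.
Variables (s : T) (p : nat) (Nb B : {set T}) (Xs0 : {set {set T}}) (N : nat).
Hypothesis hX0 : forall X, X \in Xs0 -> exists l, copy X s p Nb B l.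
Hypothesis big : #|S| + 2 < #|Xs0|.
Hypothesis nop : forall v l, bpath H v l -> size l <= N.

Lemma fresh_copy (Xs : seq {set T}) : size Xs <= #|S| + 2 ->
  exists X l, [/\ X \in Xs0, X \notin Xs & copy X s p Nb B l].
Proof.
move=> sz; have : ~~ (Xs0 \subset Xs).
  apply/negP => /subset_leq_card h.
  by have := leq_trans big (leq_trans h (leq_trans (card_size Xs) sz)); rewrite ltnn.
case/subsetPn=> X X0 nX; have [l cp] := hX0 X0.
by exists X, l.
Qed.

Lemma mem_copies : {subset Xs0 <= CC}.
Proof. by move=> X /hX0[l /cp_comp]. Qed.

Lemma B_sub_S : B \subset S.
Proof.
have [//|X [l [_ _ cp]]] := @fresh_copy [::].
exact: link_sub (cp_link cp).
Qed.

(** An arm arrives at the last vertex of the list; each earlier vertex is then reached by two edges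
    through a fresh copy, so that the path ends at [t]. *)
Lemma woven_chain t ts : uniq (t :: ts) -> {subset t :: ts <= B} ->
  exists v l Xs, [/\ woven H Xs (t :: ts) v l, pend v l = t,
    size l = p + 2 * size ts, {subset Xs <= Xs0} & size Xs = (size ts).+1].
Proof.
elim: ts t => [|t' ts IH] t.
  move=> _ sB; have [//|X [l [X0 _ cp]]] := @fresh_copy [::].
  have [|l' ar] := copy_arm cp (t := t); first by apply: sB; rewrite inE eqxx.
  have [v [l2 [wv pv sv]]] := woven_start ar.
  exists v, l2, [:: X]; split=> //; first by rewrite sv muln0 addn0.
  by move=> Y; rewrite inE => /eqP ->.
move=> /andP[tn u] sB.
have [||v [l [Xs [wv pv sv sXs szX]]]] := IH t' => //.
  by move=> z zt; apply: sB; rewrite inE zt orbT.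
have szS : size (t :: t' :: ts) <= #|S|.
  rewrite cardE; apply: uniq_leq_size; first by rewrite /= tn.
  by move=> z /sB /(subsetP B_sub_S); rewrite mem_enum.
have [|X [lX [X0 nX cp]]] := @fresh_copy Xs.
  by rewrite szX; move: szS => /=; lia.
have tB : t \in B by apply: sB; rewrite inE eqxx.
have t'B : t' \in B by apply: sB; rewrite !inE eqxx orbT.
have [|l2 [e [s2 sX b2]]] := copy_cross cp t'B tB.
  by apply: contraNneq tn => ->; rewrite inE eqxx.
exists v, (l ++ rcons l2 (e, t)), (X :: Xs); split.
- apply: (woven_cross (W := W) (S := S)) => //; rewrite ?pv ?s2 //.
  + by move=> Y /sXs /mem_copies.
  + move=> z zt; apply: (subsetP B_sub_S); apply: sB.
    by rewrite inE zt orbT.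
  + exact: mem_copies.
  + exact: (subsetP B_sub_S).
- by rewrite pend_cat pend_rcons.
- by rewrite size_cat size_rcons sv s2 /=; lia.
- by move=> Y; rewrite inE => /orP[/eqP->//|]; apply: sXs.
- by rewrite /= szX.
Qed.

Lemma sub_copies_S t ts : {subset t :: ts <= B} -> {subset t :: ts <= S}.
Proof. by move=> sB z /sB /(subsetP B_sub_S). Qed.

Lemma size_le_S t ts : uniq (t :: ts) -> {subset t :: ts <= B} -> size ts < #|S|.
Proof.
move=> u sB; rewrite cardE; apply: (@uniq_leq_size _ (t :: ts)) => //.
by move=> z /sB /(subsetP B_sub_S); rewrite mem_enum.
Qed.

Lemma weave_arms t ts : uniq (t :: ts) -> {subset t :: ts <= B} ->
  2 * p + 2 * size ts <= N.
Proof.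
move=> u sB; have lt := size_le_S u sB.
have [v [l [Xs [wv pv sv sXs szX]]]] := woven_chain u sB.
have [|X [lX [X0 nX cp]]] := @fresh_copy Xs; first by rewrite szX; lia.
have [|l' ar] := copy_arm cp (t := t); first by apply: sB; rewrite inE eqxx.
have b : bpath H v (l ++ l').
  apply: (woven_end (W := W) (S := S) (X := X) (q := p) _ _ _ nX wv).
  - by move=> Y /sXs /mem_copies.
  - exact: sub_copies_S.
  - exact: mem_copies.
  - by rewrite pv.
have := nop b; rewrite size_cat sv; case: ar => _ _ ->; lia.
Qed.

(** Instead of ending with an arm, the path traverses a fresh copy completely and returns to [s],
    which costs p + 1 edges: one more than in [weave_arms]. *)
Lemma weave_to_s t ts : uniq (t :: ts) -> {subset t :: ts <= B} ->
  s \notin t :: ts ->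
  exists v l Xs, [/\ woven H Xs (s :: t :: ts) v l, pend v l = s,
    size l = 2 * p + 2 * size ts + 1, {subset Xs <= Xs0} & size Xs = (size ts).+2].
Proof.
move=> u sB sn; have lt := size_le_S u sB.
have [v [l [Xs [wv pv sv sXs szX]]]] := woven_chain u sB.
have [|X [lX [X0 nX cp]]] := @fresh_copy Xs; first by rewrite szX; lia.
have tB : t \in B by apply: sB; rewrite inE eqxx.
have [|l2 [e [s2 sX b2]]] := copy_cross_s cp tB.
  by apply: contraNneq sn => <-; rewrite inE eqxx.
exists v, (l ++ rcons l2 (e, s)), (X :: Xs); split.
- apply: (woven_cross (W := W) (S := S)) => //; rewrite ?pv ?s2 //.
  + by move=> Y /sXs /mem_copies.
  + exact: sub_copies_S.
  + exact: mem_copies.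
  + exact: cp_s cp.
  + exact: cp_pos cp.
- by rewrite pend_cat pend_rcons.
- by rewrite size_cat size_rcons sv s2; lia.
- by move=> Y; rewrite inE => /orP[/eqP->//|]; apply: sXs.
- by rewrite /= szX.
Qed.

Lemma weave_arms_s t ts : uniq (t :: ts) -> {subset t :: ts <= B} ->
  s \notin t :: ts -> s \in B -> 3 * p + 2 * size ts + 1 <= N.
Proof.
move=> u sB sn sB'; have lt := size_le_S u sB.
have [v [l [Xs [wv pv sv sXs szX]]]] := weave_to_s u sB sn.
have [|X [lX [X0 nX cp]]] := @fresh_copy Xs; first by rewrite szX; lia.
have [l' ar] := copy_arm cp sB'.
have b : bpath H v (l ++ l').
  apply: (woven_end (W := W) (S := S) (X := X) (q := p) _ _ _ nX wv).
  - by move=> Y /sXs /mem_copies.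
  - apply: sub_copies_S => z; rewrite inE => /orP[/eqP->//|]; exact: sB.
  - exact: mem_copies.
  - by rewrite pv.
have := nop b; rewrite size_cat sv; case: ar => _ _ ->; lia.
Qed.

Lemma weave_s X l2 q : X \in Xs0 -> arm H X s l2 q -> p + q <= N.
Proof.
move=> X0 ar2; have [|X' [l [X0' nX cp]]] := @fresh_copy [:: X]; first by rewrite /=; lia.
have [v [l' [wv pv sv]]] := woven_start (cp_arm cp).
have b : bpath H v (l' ++ l2).
  apply: (woven_end (W := W) (S := S) (X := X) (q := q) _ _ _ _ wv).
  - by move=> Y; rewrite inE => /eqP ->; apply: mem_copies.
  - by move=> z; rewrite inE => /eqP ->; exact: cp_s cp.
  - exact: mem_copies.
  - by rewrite inE eq_sym; move: nX; rewrite inE.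
  - by rewrite pv.
have := nop b; rewrite size_cat sv; case: ar2 => _ _ ->; lia.
Qed.

Lemma weave_s_out X l2 q e t : X \in Xs0 -> arm H X s l2 q -> 0 < q ->
  bpath H s (rcons l2 (e, t)) -> t \in S -> t != s -> p + q + 1 <= N.
Proof.
move=> X0 ar2 q0 b2 tS ts.
have [|X' [l [X0' nX cp]]] := @fresh_copy [:: X]; first by rewrite /=; lia.
have [v [l' [wv pv sv]]] := woven_start (cp_arm cp).
have [b3 s3 sz3] := ar2.
have [b _ _] : woven H [:: X; X'] [:: t; s] v (l' ++ rcons l2 (e, t)).
  apply: (woven_cross (W := W) (S := S)) => //; rewrite ?pv ?sz3 //.
  - by move=> Y; rewrite inE => /eqP ->; apply: mem_copies.
  - by move=> z; rewrite inE => /eqP ->; exact: cp_s cp.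
  - exact: mem_copies.
  - by rewrite inE eq_sym; move: nX; rewrite inE.
  - by rewrite inE.
have := nop b; rewrite size_cat size_rcons sv sz3; lia.
Qed.

End ManyCopies.
End Copies.

(** * Irreducible vertex sets *)

(** These are the edges lost from [W] when [Y] is deleted. *)
Definition touch (T : finType) (H : {set {set T}}) (W Y : {set T}) : {set {set T}} :=
  [set e in H | (e \subset W) && ~~ [disjoint e & Y]].

(** Two edges for each [t] ensure that a path passing through [y] between two vertices of [A] can
    use different edges. *)
Definition rich (T : finType) (H : {set {set T}}) (A : {set T}) : {set T} :=
  [set y in ~: A | [forall t in A,
     1 < #|[set f in H | [&& y \in f, t \in f & f \subset y |: A]]|]].

Section Irreducible.
Variables (T : finType) (H : {set {set T}}) (r a : nat).
Hypothesis hr : 3 <= r.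
Hypothesis ha : r + 6 <= a.
Hypothesis uH : forall e, e \in H -> #|e| = r.
Hypothesis nop : forall v l, bpath H v l -> size l <= 2 * a.
Variable (W : {set T}).
Hypothesis cW : conn H W.
Hypothesis irr : forall Y : {set T}, Y \subset W -> 0 < #|Y| <= 2 ->
  conn H (W :\: Y) -> 'C(a, r.-1) * #|Y| <= #|touch H W Y|.

Section CopiesFixed.
Variables (S : {set T}) (s : T) (p : nat) (Nb B : {set T}) (Xs0 : {set {set T}}).
Hypothesis hX0 : forall X, X \in Xs0 -> exists l, copy H W S X s p Nb B l.
Hypothesis big : #|S| + 2 < #|Xs0|.

Local Notation CC := (comps H (W :\: S)).

Lemma compW X u : X \in CC -> u \in X -> u \in W.
Proof. by move=> /comps_sub/subsetP h /h; rewrite inE => /andP[]. Qed.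

(* A neighbour of the endpoint inside S is also a neighbour of the endpoint of
   any other copy, so it stays connected to s. *)
Lemma copy_noncut X l : X \in Xs0 -> copy H W S X s p Nb B l ->
  conn H (W :\: [set pend s l]).
Proof.
move=> X0 cp; set y := pend s l.
have [|X' [l' [X0' nX' cp']]] := fresh_copy hX0 big (Xs := [:: X]); first by rewrite /=; lia.
have XX' : X' != X by move: nX'; rewrite inE.
have yX : y \in X := copy_end_in cp.
have b := cp_bpath cp; have sX := cp_subX cp; have b' := cp_bpath cp'; have sX' := cp_subX cp'.
have [l3 [ep El]] : exists l3 ep, l = rcons l3 (ep, y).
  have := cp_pos cp; rewrite -(cp_size cp) /y; case/lastP: (l) => [//|l3 [ep z]] _.
  by exists l3, ep; rewrite pend_rcons.
have := b; rewrite El bpath_rcons => /and5P[b3 epH pe3 yep /andP[yn3 _]].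
have vW3 u : u \in verts s l3 -> u \in W :\: [set y].
  move=> u3; rewrite !inE; apply/andP; split; first by apply: contraNneq yn3 => <-.
  move: u3; rewrite inE => /orP[/eqP->|u3]; first exact: cp_sW cp.
  apply: (compW (cp_comp cp)); apply: sX; rewrite El /unzip2 map_rcons mem_rcons inE.
  by rewrite u3 orbT.
have vW' u : u \in verts s l' -> u \in W :\: [set y].
  rewrite inE => /orP[/eqP->|u']; first by apply: vW3; rewrite inE eqxx.
  rewrite !inE (compW (cp_comp cp')) ?sX' // andbT.
  apply: contraNneq XX' => E; apply/eqP; apply: comps_eq (cp_comp cp') (cp_comp cp) _ yX.
  by rewrite -E; apply: sX'.
(* The kernel joins the path without its end and the path of a second copy, both starting at [s]. *)
apply: (@conn_setD T H W [set y] [set u in verts s l3 ++ verts s l'] s) => //.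
- by apply/subsetP => u; rewrite inE mem_cat => /orP[/vW3|/vW'].
- by rewrite inE mem_cat inE eqxx.
- move=> k; rewrite inE mem_cat cadj_connect_sym => /orP[k3|k'].
    by apply: walk_connect k3 => //; case/and3P: b3.
  by apply: walk_connect k' => //; case/and3P: b'.
move=> y' u; rewrite inE => /eqP -> uW /adjP[e [eH ye ue]].
have [el|el] := boolP (e \in unzip1 l).
  suff [k kl ke] : exists2 k, k \in verts s l3 & k \in e.
    by exists k; [rewrite inE mem_cat kl | rewrite (adjI eH ue ke) orbT].
  move: el; rewrite El /unzip1 map_rcons mem_rcons inE => /orP[/eqP->|el3].
    by exists (pend s l3); first exact: pend_in.
  have [_ [w [z [_ z3 _ ze _]]]] := bpath_edge b3 el3.
  by exists z => //; rewrite inE z3 orbT.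
have [uy uW'] : u != y /\ u \in W by move: uW; rewrite !inE => /andP[].
have [uS|ul] := copy_free_vert cp eH ye el ue uW'.
  have : u \in Nb by rewrite (cp_nb cp) inE uS; apply: adjI eH ye ue.
  rewrite (cp_nb cp') inE => /andP[_ yu].
  by exists (pend s l'); rewrite ?inE ?mem_cat ?pend_in ?orbT // adj_sym yu orbT.
exists u; last by rewrite eqxx.
move: ul; rewrite El /unzip2 map_rcons mem_rcons !inE (negPf uy) /= => ul.
by rewrite mem_cat inE ul orbT.
Qed.

Lemma copy_degree X l : X \in Xs0 -> copy H W S X s p Nb B l ->
  'C(a, r.-1) <= #|touch H W [set pend s l]|.
Proof.
move=> X0 cp; rewrite -[X in X <= _]muln1 -(cards1 (pend s l)); apply: irr.
- by rewrite sub1set (compW (cp_comp cp)) // (copy_end_in cp).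
- by rewrite cards1.
- exact: copy_noncut cp.
Qed.

Lemma touch1P e y : e \in touch H W [set y] -> [/\ e \in H, e \subset W & y \in e].
Proof.
rewrite inE => /and3P[eH eW]; rewrite disjoint_sym disjoints1 negbK.
by [].
Qed.

Local Notation hv l := (heavy S (free_edges H W s l)).
Local Notation light_edges l :=
  [set f in free_edges H W s l | ~~ (f :&: S \subset hv l)].

(** Let [Z] be the heavy vertices and the path vertices after [s]. An edge at the end lies inside
    [Z], or is a path edge, or by non-extendability meets [S] in a non-heavy vertex. *)
Lemma copy_touch_le X l : X \in Xs0 -> copy H W S X s p Nb B l ->
  #|touch H W [set pend s l]| <=
  'C(#|hv l| + p.-1, r.-1) + #|light_edges l| + kappa r p.
Proof.
move=> X0 cp; set y := pend s l.
set Z := hv l :|: [set u in unzip2 l].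
have b := cp_bpath cp.
have yl : y \in unzip2 l := copy_end_unzip cp.
apply: leq_trans (_ : #|[set e in H | (y \in e) && (e \subset Z)]| + #|light_edges l|
   + #|[set e in unzip1 l | (pend s l \in e) && ~~ (e \subset Z)]| <= _).
  apply: leq_trans (_ : #|[set e in H | (y \in e) && (e \subset Z)] :|: light_edges l|
   + #|[set e in unzip1 l | (pend s l \in e) && ~~ (e \subset Z)]| <= _); last first.
    by rewrite leq_add2r; case: (leq_card_setU [set e in H | (y \in e) && (e \subset Z)] (light_edges l)).
  apply: leq_trans (leq_card_setU _ _); apply: subset_leq_card; apply/subsetP => e.
  case/touch1P=> eH eW ye; rewrite !in_setU.
  have [eZ|nZ] := boolP (e \subset Z); first by rewrite inE eH ye eZ.
  have [el|el] := boolP (e \in unzip1 l).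
    by apply/orP; right; rewrite inE el ye nZ.
  apply/orP; left; apply/orP; right; rewrite inE.
  rewrite [e \in free_edges _ _ _ _]inE eH ye eW el /=.
  case/subsetPn: nZ => u ue uZ; apply/subsetPn; exists u.
    rewrite inE ue /=; case: (copy_free_vert cp eH ye el ue (subsetP eW _ ue)) => // ul.
    by case/negP: uZ; rewrite !inE ul orbT.
  by apply: contra uZ => uh; rewrite in_setU uh.
apply: leq_add; first apply: leq_add => //.
  apply: leq_trans (card_edges_at (y := y) (Z := Z) (r := r) _ _) _.
  + by rewrite !inE yl orbT.
  + by move=> e; rewrite inE => /and3P[eH ye eZ]; split=> //; apply: uH.
  + apply: leq_bin2l.
    have [+ _] := leq_card_setU (hv l) [set u in unzip2 l].
    have : #|[set u in unzip2 l]| <= p.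
      by rewrite cardsE -(cp_size cp) -(size_map snd l); apply: card_size.
    rewrite -/Z; move: #|Z| #|hv l| #|[set u in _]| (cp_pos cp) => c1 c2 c3; lia.
rewrite -(cp_size cp); apply: (path_edges_out uH b).
by move=> u ul; rewrite !inE ul orbT.
Qed.

(* h: vertices seen by the endpoint; q: its edges through a vertex of S covered
   only once; k: the length of the path. *)
Lemma degree_numeric h q k : 'C(a, r.-1) <= 'C(h, r.-1) + q + kappa r k ->
  k <= a.+1 -> h + q <= a -> a <= h.
Proof.
move=> le ka hq; rewrite leqNgt; apply/negP => lt.
have gap := binom_gap hr ha; have kk := leq_kappa r ka; have bp := binom_pred hr ha.
(* If h < a, the degree exceeds C(a-1, r-1) by at most one plus the [kappa] term, against
   [binom_gap]. *)
have : 'C(h, r.-1) + q.-1 <= 'C(a.-1, r.-1) by apply: bin_addl; lia.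
move: bp le gap kk; move: ('C(a, r.-1)) ('C(h, r.-1)) ('C(a.-1, r.-1)) ('C(a.-1, r.-2)) (kappa r k) (kappa r a.+1).
move=> *; lia.
Qed.

Lemma some_copy : exists X l, X \in Xs0 /\ copy H W S X s p Nb B l.
Proof. by have [//|X [l [X0 _ cp]]] := fresh_copy hX0 big (Xs := [::]); exists X, l. Qed.

Lemma p_le_a : p <= a.
Proof.
have [X [l [X0 cp]]] := some_copy.
have := weave_s hX0 big nop X0 (cp_arm cp); lia.
Qed.

Lemma B_nonempty_le : 0 < #|B| -> p.-1 + #|B| <= a /\ (p.-1 + #|B| = a -> s \in B).
Proof.
move=> B0.
have : uniq (enum B) by apply: enum_uniq.
have : {subset enum B <= B} by move=> z; rewrite mem_enum.
have : #|B| = size (enum B) by rewrite cardE.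
have sE : (s \in enum B) = (s \in B) by rewrite mem_enum.
case E : (enum B) sE => [|t ts] sE sz sB u; first by move: B0; rewrite sz.
have le := weave_arms hX0 big nop u sB; have {}sz : #|B| = (size ts).+1 := sz.
have [X [l [X0 cp]]] := some_copy; have p0 := cp_pos cp.
have aux k b : 2 * p + 2 * k <= 2 * a -> b = k.+1 -> p.-1 + b <= a by move: p0; clear; lia.
split; first exact: aux le sz.
move=> M; rewrite -sE; apply/negPn/negP => sn.
have [v [l' [Xs [wv _ szl _ _]]]] := weave_to_s hX0 big u sB sn.
have aux2 k b : 2 * p + 2 * k + 1 <= 2 * a -> b = k.+1 -> p.-1 + b <> a.
  by move: p0; clear; lia.
have := nop (wv_path wv); rewrite szl => le2; exact: aux2 le2 sz M.
Qed.

(** With [B] empty there are neither heavy vertices nor light edges, so the degree estimate would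
    force a <= p - 1, while p <= a. *)
Lemma card_B_pos : 0 < #|B|.
Proof.
rewrite lt0n; apply/eqP => B0.
have [X [l [X0 cp]]] := some_copy.
have deg := leq_trans (copy_degree X0 cp) (copy_touch_le X0 cp).
have := link_count (cp_link cp); rewrite B0 => cnt.
have pa := p_le_a; have p0 := cp_pos cp.
by have := degree_numeric deg; move: cnt; lia.
Qed.

Lemma heavy_ge X l : X \in Xs0 -> copy H W S X s p Nb B l -> a <= #|hv l| + p.-1.
Proof.
move=> X0 cp.
have deg := leq_trans (copy_degree X0 cp) (copy_touch_le X0 cp).
have cnt := link_count (cp_link cp).
have [M _] := B_nonempty_le card_B_pos.
have pa := p_le_a.
by apply: (degree_numeric deg); move: cnt M; lia.
Qed.

Lemma copy_card : p.-1 + #|B| = a.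
Proof.
have [X [l [X0 cp]]] := some_copy; have := heavy_ge X0 cp.
have := link_count (cp_link cp); have [M _] := B_nonempty_le card_B_pos; move: M; lia.
Qed.

(** The degree bound and the path bound meet at [a], so equality holds throughout [link_count]. *)
Lemma copy_heavy X l : X \in Xs0 -> copy H W S X s p Nb B l ->
  hv l = B /\ light_edges l = set0.
Proof.
move=> X0 cp; have := heavy_ge X0 cp; have := copy_card; have := link_count (cp_link cp).
move=> h1 h2 h3; split.
  by apply/eqP; rewrite eqEcard (link_heavy (cp_link cp)); move: h1 h2 h3; lia.
by apply/eqP; rewrite -cards_eq0; move: h1 h2 h3; lia.
Qed.

Lemma s_in_B : s \in B.
Proof. by have [_] := B_nonempty_le card_B_pos; apply; apply: copy_card. Qed.

(** If [B] has vertices besides [s], weave through them, cross a copy to [s] and leave by a third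
    arm. The resulting 3p + 2(|B| - 2) + 1 edges are at most 2a = 2(p - 1 + |B|), so p <= 1. *)
Lemma p1_or_B1 : p = 1 \/ #|B| = 1.
Proof.
have [X [l [X0 cp]]] := some_copy; have p0 := cp_pos cp; have M := copy_card; have B0 := card_B_pos.
case: (ltngtP p 1) => [|p2|->]; [lia | right | by left].
apply/eqP; rewrite eqn_leq B0 andbT leqNgt; apply/negP => B2.
have : uniq (enum (B :\ s)) by apply: enum_uniq.
have sB' : {subset enum (B :\ s) <= B} by move=> z; rewrite mem_enum !inE => /andP[].
have sn : s \notin enum (B :\ s) by rewrite mem_enum !inE eqxx.
have sz : #|B| = (size (enum (B :\ s))).+1 by rewrite -cardE (cardsD1 s B) s_in_B.
case E : (enum (B :\ s)) sB' sn sz => [|t ts] sB' sn sz u; first by move: B2; rewrite sz.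
have := weave_arms_s hX0 big nop u sB' sn s_in_B.
have aux k b : 3 * p + 2 * k + 1 <= 2 * a -> b = k.+2 -> 1 < p -> p.-1 + b <> a.
  by clear; lia.
by move=> le; apply: aux le sz p2 M.
Qed.

(** * Excluding a block of a + 1 vertices hanging on [s] *)

Section Block.
Hypothesis B1 : #|B| = 1.

Lemma block_p : p = a.
Proof. by have := copy_card; rewrite B1; have [X [l [X0 cp]]] := some_copy; have := cp_pos cp; lia. Qed.

(** A new vertex of [S] after the arm would give, together with an arm of another copy, a path with
    2a + 1 edges; a new vertex of [X] would lengthen a longest arm. *)
Lemma block_free X l l' g u : X \in Xs0 -> copy H W S X s p Nb B l ->
  arm H X s l' p -> g \in H -> pend s l' \in g -> g \notin unzip1 l' ->
  u \in g -> u \in W -> u \in verts s l'.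
Proof.
move=> X0 cp ar gH yg gl ug uW; apply/negPn/negP => un.
have [b' sX' sz'] := ar; have p0 := cp_pos cp.
have b2 : bpath H s (rcons l' (g, u)) by rewrite bpath_rcons b' gH yg ug un gl.
have yX : pend s l' \in X.
  apply: sX'; move: p0; rewrite -sz' /pend; case: (l') => [|[e z] l2] //= _.
  exact: mem_last.
have [uS|uS] := boolP (u \in S).
  have us : u != s by apply: contraNneq un => ->; rewrite inE eqxx.
  by have := weave_s_out hX0 big nop X0 ar p0 b2 uS us; rewrite block_p mul2n addnn addn1 ltnn.
have uX : u \in X.
  apply: (comps_closed (cp_comp cp) yX); first by rewrite inE uS.
  exact: adjI gH yg ug.
have : arm H X s (rcons l' (g, u)) p.+1.
  split=> //; last by rewrite size_rcons sz'.
  move=> z; rewrite /unzip2 map_rcons mem_rcons inE => /orP[/eqP->//|]; exact: sX'.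
by move/(cp_max cp); rewrite ltnn.
Qed.

(* Rotating at s makes the first vertex x1 of the path an endpoint as well;
   deleting both endpoints destroys fewer than 2 C(a, r-1) edges. *)
Lemma block_absurd : False.
Proof.
have [X [l [X0 cp]]] := some_copy; have ea := block_p.
have ar := cp_arm cp; have b := cp_bpath cp; have sX := cp_subX cp; have sz := cp_size cp.
set y := pend s l.
have [f fF sf] := link_cover (cp_link cp) s_in_B.
have [fH yf _ fl] := free_edgesP fF.
have [l' [e1' [ar' _ _ _ [_ hd1 sub1 sub2]]]] := copy_arm_from cp (cp_s cp) fH yf fl sf.
have gap := binom_gap hr ha; have bp := binom_pred hr ha.
have [e1 [x1 [e2 [x2 [l3 [ep El]]]]]] : exists e1 x1 e2 x2 l3 ep,
    l = (e1, x1) :: (e2, x2) :: rcons l3 (ep, y).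
  have : 2 < size l by rewrite sz ea; move: hr ha; clear; lia.
  rewrite /y; case: (l) => [|[e1 x1] [|[e2 x2] l2]] //.
  case/lastP: l2 => [//|l3 [ep z]] _; exists e1, x1, e2, x2, l3, ep.
  by rewrite -!rcons_cons pend_rcons.
have x1E : pend s l' = x1 by move: hd1; rewrite El => -[].
set Z := [set u in verts s l].
have cZ : #|Z| = a.+1 by rewrite card_verts ?sz ?ea //; case/and3P: b.
have uZ : uniq (verts s l) by case/and3P: b.
have memZ u : (u \in Z) = [|| u == s, u == x1, u == y | u \in verts x2 l3].
  rewrite inE El /verts /= !inE /unzip2 map_rcons mem_rcons !inE.
  by do !case: (u == _) => //=; rewrite ?orbT.
have uniqs : [/\ s != x1, s != y, s \notin verts x2 l3,
     x1 != y & (x1 \notin verts x2 l3) && (y \notin verts x2 l3)].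
  move: uZ; rewrite El /verts /= /unzip2 map_rcons !inE !mem_rcons !inE -/(unzip2 l3).
  rewrite !negb_or -!andbA rcons_uniq.
  case/and5P=> -> h2 h3 h4 /and5P[h5 h6 h7 h8 /andP[h9 h10]].
  split=> //; first by rewrite h2 h4.
  by rewrite h5 h7 eq_sym h8; case/andP: h10.
have [sx1 sy s3 x1y /andP[x13 y3]] := uniqs.
have inW u : u \in verts s l -> u \in W.
  rewrite inE => /orP[/eqP->|ul]; first exact: cp_sW cp.
  by apply: (compW (cp_comp cp)); apply: sX.
have vin u : u \in verts x2 l3 -> u \in verts s l.
  by move=> u3; have := memZ u; rewrite u3 !orbT inE.
have free1 g u : g \in H -> y \in g -> g \notin unzip1 l -> u \in g -> u \in W -> u \in Z.
  by move=> gH yg gl ug uW; rewrite inE; apply: (block_free X0 cp ar gH yg gl ug uW).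
have free2 g u : g \in H -> x1 \in g -> g \notin unzip1 l' -> u \in g -> u \in W -> u \in Z.
  rewrite -x1E => gH yg gl ug uW; rewrite inE.
  have := block_free X0 cp ar' gH yg gl ug uW; rewrite !inE => /orP[->//|/sub2 ->].
  by rewrite orbT.
have out1 : #|[set e in unzip1 l | (pend s l \in e) && ~~ (e \subset Z)]| <= kappa r a.+1.
  apply: leq_trans (path_edges_out uH b _) _; last by apply: leq_kappa; rewrite sz ea leqnSn.
  by move=> u ul; rewrite inE inE ul orbT.
have out2 : #|[set e in unzip1 l' | (pend s l' \in e) && ~~ (e \subset Z)]| <= kappa r a.+1.
  have [b' _ sz'] := ar'.
  apply: leq_trans (path_edges_out uH b' _) _; last by apply: leq_kappa; rewrite sz' ea leqnSn.
  by move=> u /sub2 ul; rewrite inE inE ul orbT.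
have yZ : y \in Z by rewrite memZ eqxx !orbT.
have x1Z : x1 \in Z by rewrite memZ eqxx !orbT.
have sZ : s \in Z by rewrite memZ eqxx.
have touchy e : e \in H -> e \subset W -> y \in e ->
    (e \subset Z) || (e \in [set e in unzip1 l | (pend s l \in e) && ~~ (e \subset Z)]).
  move=> eH eW ye; have [//|nZ /=] := boolP (e \subset Z); rewrite inE ye nZ !andbT.
  apply/negPn/negP => el; case/subsetPn: nZ => u ue /negP; apply.
  exact: (free1 e u eH ye el ue (subsetP eW _ ue)).
have touchx e : e \in H -> e \subset W -> x1 \in e ->
    (e \subset Z) || (e \in [set e in unzip1 l' | (pend s l' \in e) && ~~ (e \subset Z)]).
  move=> eH eW ye; have [//|nZ /=] := boolP (e \subset Z); rewrite inE x1E ye nZ !andbT.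
  apply/negPn/negP => el; case/subsetPn: nZ => u ue /negP; apply.
  exact: (free2 e u eH ye el ue (subsetP eW _ ue)).
(* Otherwise the only edge inside [Z] through both [y] and [s] is the triple with [x1], and the
   degree of [y] falls below C(a, r-1). *)
have [z z3 sz3] : exists2 z, z \in verts x2 l3 & adj H s z.
  apply: NNPP => nex.
  have none e z : e \in H -> s \in e -> z \in e -> z \notin verts x2 l3.
    by move=> eH se ze; apply/negP => z3; apply: nex; exists z => //; apply: adjI eH se ze.
  have deg := copy_degree X0 cp.
  suff : #|touch H W [set y]| <= 'C(a.-1, r.-1) + 1 + kappa r a.+1.
    have aux c1 c2 k t : c1 + c2 <= t -> 2 * k + 2 < c2 -> t <= c1 + 1 + k -> False.
      by clear; lia.
    by move: deg; rewrite -/y bp => deg; apply: aux deg gap.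
  apply: leq_trans (_ : #|([set e in H | (y \in e) && (e \subset Z :\ s)] :|: [set [set y; s; x1]])
    :|: [set e in unzip1 l | (pend s l \in e) && ~~ (e \subset Z)]| <= _).
    apply: subset_leq_card; apply/subsetP => e /touch1P[eH eW ye].
    rewrite 2!in_setU; case/orP: (touchy _ eH eW ye) => [eZ|->]; last by rewrite orbT.
    apply/orP; left; have [se|se] := boolP (s \in e); last first.
      by apply/orP; left; rewrite inE eH ye subsetD1 eZ se.
    apply/orP; right; rewrite in_set1 eqEcard; apply/andP; split.
      apply/subsetP => u ue; have := subsetP eZ _ ue; rewrite memZ (negPf (none _ _ eH se ue)) !inE.
      by case/or4P=> // ->; rewrite ?orbT.
    rewrite (uH eH); apply: leq_trans hr.
    by rewrite -setUA cardsU1 cards2; case: (_ \notin _); case: (s != x1).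
  apply: leq_trans (leq_card_setU _ _) _; apply: leq_add => //.
  apply: leq_trans (leq_card_setU _ _) _; apply: leq_add; last by rewrite cards1.
  apply: leq_trans (card_edges_at (y := y) (Z := Z :\ s) (r := r) _ _) _.
  - by rewrite in_setD1 eq_sym sy yZ.
  - by move=> e; rewrite inE => /and3P[eH ye eZ]; split=> //; apply: uH.
  - by apply: leq_bin2l; move: cZ; rewrite (cardsD1 s Z) sZ add1n => -[->].
have cY : #|[set y; x1]| = 2 by rewrite cards2 eq_sym x1y.
have vK u : u \in s :: verts x2 l3 -> u \in W :\: [set y; x1].
  rewrite inE => /orP[/eqP->|u3]; rewrite !inE negb_or.
    by rewrite sy sx1 (cp_sW cp).
  rewrite inW ?vin // andbT; apply/andP; split.
    by apply: contraNneq y3 => <-.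
  by apply: contraNneq x13 => <-.
have edgeK e : e \in unzip1 l -> exists2 k, k \in s :: verts x2 l3 & k \in e.
  move: b; rewrite El !bpath_cons => /and5P[_ se1 _ _ /andP[_]].
  case/and5P=> _ _ x2e2 _ /andP[_]; rewrite bpath_rcons => /and5P[b3 _ pep _ _].
  rewrite /= !inE /unzip1 map_rcons mem_rcons inE.
  case/or4P=> [/eqP->|/eqP->|/eqP->|el].
  - by exists s; rewrite ?inE ?eqxx.
  - by exists x2; rewrite ?inE ?eqxx ?orbT.
  - by exists (pend x2 l3); rewrite // inE pend_in orbT.
  - have [_ [w [k [_ kl _ ke _]]]] := bpath_edge b3 el.
    by exists k; rewrite // !inE kl !orbT.
(* The kernel is [s] with the inner vertices of the path, attached to [s] through [z]. Edges of
   either path meet it, and all other edges at [y] or [x1] stay inside [Z]. *)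
have cWY : conn H (W :\: [set y; x1]).
  apply: (@conn_setD T H W [set y; x1] [set u in s :: verts x2 l3] s) => //.
  - by apply/subsetP => u; rewrite inE => /vK.
  - by rewrite inE inE eqxx.
  - have w3 : walk H x2 l3.
      move: b; rewrite El !bpath_cons => /and5P[_ _ _ _ /andP[_]].
      by case/and5P=> _ _ _ _ /andP[_]; rewrite bpath_rcons => /and5P[/and3P[]].
    have c3 k : k \in verts x2 l3 -> connect (cadj H (W :\: [set y; x1])) x2 k.
      by apply: walk_connect => // u u3; apply: vK; rewrite inE u3 orbT.
    move=> k; rewrite inE inE => /orP[/eqP->|k3]; first exact: connect0.
    apply: connect_trans (_ : connect _ z s); last first.
      apply: connect1; rewrite /cadj adj_sym sz3 !vK ?inE ?eqxx //.
      by move: z3; rewrite inE => ->; rewrite orbT.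
    by apply: connect_trans (c3 _ z3); rewrite cadj_connect_sym; apply: c3.
  - move=> y' u y'Y uW /adjP[e [eH ye ue]].
    have [uW' uY] : u \in W /\ u \notin [set y; x1] by move: uW; rewrite in_setD => /andP[].
    have uZK : u \in Z -> exists2 k, k \in [set u in s :: verts x2 l3] & (u == k) || adj H u k.
      move=> uZ'; exists u; last by rewrite eqxx.
      move: uZ'; rewrite memZ => /or4P[/eqP->|/eqP E|/eqP E|u3].
      - by rewrite inE inE eqxx.
      - by case/negP: uY; rewrite E !inE eqxx orbT.
      - by case/negP: uY; rewrite E !inE eqxx.
      - by rewrite inE inE u3 orbT.
    have edgeK' : (exists2 k, k \in s :: verts x2 l3 & k \in e) ->
        exists2 k, k \in [set u in s :: verts x2 l3] & (u == k) || adj H u k.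
      by case=> k kK ke; exists k; rewrite ?inE // (adjI eH ue ke) orbT.
    move: y'Y ye; rewrite !inE => /orP[]/eqP-> ye.
      have [el|el] := boolP (e \in unzip1 l); first by apply: edgeK'; apply: edgeK.
      by apply: uZK; apply: (free1 e u eH ye el ue uW').
    have [el|el] := boolP (e \in unzip1 l').
      apply: edgeK'; move/sub1: el; rewrite inE => /orP[/eqP->|/edgeK//].
      by exists s => //; rewrite inE eqxx.
    by apply: uZK; apply: (free2 e u eH ye el ue uW').
have := @irr [set y; x1]; rewrite cY => /(_ _ isT cWY).
have -> : [set y; x1] \subset W.
  apply/subsetP => u; rewrite !inE => /orP[]/eqP->; apply: inW.
    by move: yZ; rewrite inE.
  by move: x1Z; rewrite inE.
move/(_ isT).
(* Edges through both ends are counted only at [y], so those counted at [x1] inside [Z] avoid [y]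
   and number at most C(a-1, r-1). *)
suff : #|touch H W [set y; x1]| <=
    ('C(a, r.-1) + 'C(a.-1, r.-1)) + (kappa r a.+1 + kappa r a.+1).
  have aux c1 c2 k t : 2 * k + 2 < c2 -> t <= c1 + c2 + c1 + (k + k) ->
      (c1 + c2) * 2 <= t -> False by clear; lia.
  by rewrite bp; apply: aux gap.
apply: leq_trans (_ : #|([set e in H | (y \in e) && (e \subset Z)]
    :|: [set e in H | (x1 \in e) && (e \subset Z :\ y)])
  :|: ([set e in unzip1 l | (pend s l \in e) && ~~ (e \subset Z)]
    :|: [set e in unzip1 l' | (pend s l' \in e) && ~~ (e \subset Z)])| <= _).
  apply: subset_leq_card; apply/subsetP => e; rewrite inE => /and3P[eH eW].
  rewrite 3!in_setU => dY.
  have [ye|ye] := boolP (y \in e).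
    by case/orP: (touchy _ eH eW ye) => [eZ|->]; rewrite ?orbT // inE eH ye eZ.
  have x1e : x1 \in e.
    apply: contraNT dY => x1e; rewrite disjoint_subset; apply/subsetP => u ue.
    rewrite !inE negb_or; apply/andP; split; first by apply: contraNneq ye => <-.
    by apply: contraNneq x1e => <-.
  case/orP: (touchx _ eH eW x1e) => [eZ|->]; rewrite ?orbT //.
  apply/orP; left; apply/orP; right.
  by rewrite inE eH x1e subsetD1 eZ ye.
apply: leq_trans (leq_card_setU _ _) _; apply: leq_add.
  apply: leq_trans (leq_card_setU _ _) _; apply: leq_add.
    apply: leq_trans (card_edges_at (y := y) (Z := Z) (r := r) yZ _) _.
      by move=> e; rewrite inE => /and3P[eH ye eZ]; split=> //; apply: uH.
    by rewrite cZ.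
  apply: leq_trans (card_edges_at (y := x1) (Z := Z :\ y) (r := r) _ _) _.
  - by rewrite in_setD1 x1y x1Z.
  - by move=> e; rewrite inE => /and3P[eH ye eZ]; split=> //; apply: uH.
  - by apply: leq_bin2l; move: cZ; rewrite (cardsD1 y Z) yZ add1n => -[->].
by apply: leq_trans (leq_card_setU _ _) _; apply: leq_add.
Qed.

End Block.

(** For p = 1 the absence of light edges keeps the free edges at the end inside [B] and the end, and
    heaviness of all of [B] makes the end rich. Distinct components give distinct rich vertices. *)
Lemma copies_rich : #|B| = a /\ #|Xs0| <= #|rich H B|.
Proof.
case: p1_or_B1 => [p1|/block_absurd//].
have cB : #|B| = a by have := copy_card; rewrite p1.
split=> //.
have hasy X : X \in Xs0 -> exists y, y \in X :&: rich H B.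
  move=> X0; have [l cp] := hX0 X0; exists (pend s l).
  have yX := copy_end_in cp; have yS := comp_disj (cp_comp cp) yX.
  have [hvB lt0] := copy_heavy X0 cp.
  rewrite in_setI yX /= inE in_setC; apply/andP; split.
    by apply: contra yS; apply: (subsetP (link_sub (cp_link cp))).
  apply/forall_inP => t; rewrite -{1}hvB inE => /andP[_ ct].
  apply: leq_trans ct _; apply: subset_leq_card; apply/subsetP => f.
  rewrite inE => /andP[fF tf]; have [fH yf fW fl] := free_edgesP fF.
  rewrite inE fH yf tf /=; apply/subsetP => u uf.
  case: (copy_free_vert cp fH yf fl uf (subsetP fW _ uf)) => [uS|].
    have : f \notin [set g in free_edges H W s l | ~~ (g :&: S \subset hv l)] by rewrite lt0 inE.
    rewrite inE fF /= negbK hvB => /subsetP/(_ u); rewrite inE uf uS => /(_ isT) uB.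
    by rewrite in_setU uB orbT.
  have := cp_size cp; rewrite p1 /pend; case: (l) => [|[e x] [|]] //= _.
  by rewrite inE => /eqP ->; rewrite !inE eqxx.
pose pk (X : {set T}) := [pick y in X :&: rich H B].
have pkP X : X \in Xs0 -> exists y, [/\ pk X = Some y, y \in X & y \in rich H B].
  move=> /hasy[y yX]; rewrite /pk; case: pickP => [z /setIP[zX zr]|/(_ y)]; first by exists z.
  by rewrite yX.
have Sinj : injective (@Some T) by move=> ? ? [].
rewrite -(card_imset (rich H B) Sinj) -(card_in_imset (f := pk) (D := Xs0)).
  apply: subset_leq_card; apply/subsetP => _ /imsetP[X /pkP[y [-> _ yr]] ->].
  exact: imset_f.
move=> X X' X0 X0'; have [y [-> yX _]] := pkP _ X0; have [y' [-> yX' _]] := pkP _ X0'.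
move=> [E]; subst y'.
by apply: comps_eq yX yX'; apply: (mem_copies hX0).
Qed.

End CopiesFixed.
End Irreducible.

(** * From rich structure to the bound *)

(** Types are assigned by a propositional relation, so a type function is chosen first and its
    fibres are counted. *)
Lemma pigeonhole_rel (I D : finType) (A : {set I}) (V : {set D}) (R : I -> D -> Prop) k :
  (forall x, x \in A -> exists2 d, d \in V & R x d) -> #|V| * k < #|A| ->
  exists d, exists A' : {set I}, [/\ A' \subset A, k < #|A'| & forall x, x \in A' -> R x d].
Proof.
move=> hR lt.
have [x0 x0A] : exists x, x \in A by apply/card_gt0P; apply: leq_ltn_trans lt.
have [d0 _ _] := hR _ x0A.
have [f fP] : exists f : I -> D, forall x, x \in A -> f x \in V /\ R x (f x).
  apply: (fin_all_exists (P := fun x d => x \in A -> d \in V /\ R x d)) => x; have [xA|xA] := boolP (x \in A); last by exists d0.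
  by have [d dV Rd] := hR _ xA; exists d.
have [/exists_inP[d dV kd]|] := boolP [exists d in V, k < #|[set x in A | f x == d]|].
  exists d, [set x in A | f x == d]; split=> //.
    by apply/subsetP => x; rewrite inE => /andP[].
  by move=> x; rewrite inE => /andP[xA /eqP <-]; case: (fP _ xA).
rewrite negb_exists_in => /forall_inP small.
suff : #|A| <= #|V| * k by rewrite leqNgt lt.
rewrite -sum1_card (partition_big f (mem V)) /=; last by move=> x /fP[].
apply: leq_trans (_ : \sum_(d in V) k <= _); last by rewrite sum_nat_const.
apply: leq_sum => d dV; have := small _ dV; rewrite -leqNgt; apply: leq_trans.
by rewrite sum1dep_card; apply: subset_leq_card; apply/subsetP => x; rewrite !inE.
Qed.

Definition inner (T : finType) (H : {set {set T}}) (W : {set T}) : {set {set T}} :=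
  [set e in H | e \subset W].

(** * Thresholds, and reduction to irreducible sets *)

Section IrreducibleRich.
Variables (r a : nat).

(** The constants bound, in turn, the separating set [S], the number of types, the components that
    force more than [sep_bound + a + 4] equal types, and the size of [W] that yields them. *)
Definition sep_bound : nat := 1 + r * (2 * a).+1.
Definition type_bound : nat := sep_bound * (2 * a).+1 * (2 ^ sep_bound * 2 ^ sep_bound).
Definition comps_needed : nat := (type_bound * (sep_bound + a + 4)).+2.
Definition large_bound : nat :=
  comps_needed * comp_bound comps_needed r (2 * a).+1 + 1.

Definition irreducible (T : finType) (H : {set {set T}}) (W : {set T}) : Prop :=
  forall Y : {set T}, Y \subset W -> 0 < #|Y| <= 2 ->
  conn H (W :\: Y) -> 'C(a, r.-1) * #|Y| <= #|touch H W Y|.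

Lemma irreducible_rich (T : finType) (H : {set {set T}}) (W : {set T}) :
  3 <= r -> r + 6 <= a -> (forall e, e \in H -> #|e| = r) ->
  (forall v l, bpath H v l -> size l <= 2 * a) ->
  conn H W -> irreducible H W -> large_bound < #|W| ->
  exists A : {set T}, #|A| = a /\ a + 2 <= #|rich H A|.
Proof.
move=> hr ha uH nop cW irr big.
have [|S [cS cL]] := many_comps (L := comps_needed) uH cW _ big.
  by move=> v l /nop; rewrite ltnS.
set CC := comps H (W :\: S) in cL.
pose V := setX (setX S [set: 'I_(2 * a).+1]) (setX (powerset S) (powerset S)).
have cV : #|V| <= type_bound.
  rewrite !cardsX cardsT card_ord !card_powerset /type_bound.
  apply: leq_mul; first by apply: leq_mul.
  by apply: leq_mul; apply: leq_pexp2l.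
pose R (X : {set T}) (d : (T * 'I_(2 * a).+1) * ({set T} * {set T})) :=
  exists l, copy H W S X d.1.1 d.1.2 d.2.1 d.2.2 l.
have hR X : X \in CC -> exists2 d, d \in V & R X d.
  move=> XC; have c2 : 1 < #|CC| by apply: leq_trans cL.
  have [s [p [Nb [B [l cp]]]]] := exists_copy cW c2 XC nop.
  have pa : p < (2 * a).+1 by rewrite ltnS -(cp_size cp); apply: nop (cp_bpath cp).
  exists ((s, Ordinal pa), (Nb, B)); last by exists l.
  rewrite !inE /= (cp_s cp) (link_sub (cp_link cp)) (cp_nb cp) !andbT.
  by apply/subsetP => t; rewrite inE => /andP[].
(* This many copies exceed [#|S| + 2], as weaving demands, and give the a + 2 rich vertices. *)
have [|d [Xs [sXs cXs hXs]]] := pigeonhole_rel (k := sep_bound + a + 4) hR.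
  apply: leq_trans cL; rewrite /comps_needed ltnS; apply: leqW; apply: leq_mul => //.
have bigX : #|S| + 2 < #|Xs|.
  apply: leq_trans cXs; rewrite ltnS; apply: leq_trans (_ : sep_bound + 4 <= _).
    by apply: leq_add.
  by rewrite -addnA leq_add2l leq_addl.
have [cB cr] := copies_rich hr ha uH nop cW irr hXs bigX.
exists d.2.2; split=> //; apply: leq_trans cr; apply: leq_trans (ltnW cXs).
by rewrite -addnA; apply: leq_trans (leq_addl _ _); rewrite leq_add2l.
Qed.

(* Each deletion of one or two vertices loses fewer than C(a, r-1) edges per
   vertex, i.e. saves at least half an edge per vertex. *)
Lemma reduce (T : finType) (H : {set {set T}}) (W : {set T}) : conn H W ->
  2 * #|inner H W| + #|W| <= 2 * ('C(a, r.-1) * #|W|) + (2 * 2 ^ large_bound + large_bound)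
  \/ exists W', [/\ conn H W', large_bound < #|W'| & irreducible H W'].
Proof.
have [n] := ubnP #|W|; elim: n W => // n IH W lt cW.
have [small|big] := leqP #|W| large_bound.
  (* A set of bounded size contains at most 2 to the power [large_bound] edges. *)
  left; apply: leq_trans (leq_addl _ _); apply: leq_add => //.
  rewrite leq_mul2l /=; apply: leq_trans (_ : #|powerset W| <= _).
    by apply: subset_leq_card; apply/subsetP => e; rewrite !inE => /andP[].
  by rewrite card_powerset leq_pexp2l.
case: (classic (irreducible H W)) => [irr|]; first by right; exists W.
move=> nirr.
have [Y [YW cY cWY few]] : exists Y : {set T}, [/\ Y \subset W, 0 < #|Y| <= 2,
    conn H (W :\: Y) & #|touch H W Y| < 'C(a, r.-1) * #|Y|].
  apply: NNPP => nex; apply: nirr => Y YW cY cWY.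
  by rewrite leqNgt; apply/negP => lt'; apply: nex; exists Y.
have cW' : #|W| = #|W :\: Y| + #|Y|.
  by rewrite -(cardsID Y W) (setIidPr YW) addnC.
have [||le|ex] := IH (W :\: Y) => //; last by right.
  by move: lt; rewrite cW' ltnS; case/andP: cY => Y0 _; apply: leq_trans; rewrite -addn1 leq_add2l.
left.
have le2 : #|inner H W| <= #|inner H (W :\: Y)| + #|touch H W Y|.
  apply: leq_trans (leq_card_setU _ _); apply: subset_leq_card; apply/subsetP => e.
  rewrite !inE => /andP[eH eW]; rewrite eH eW /= subsetD eW /=.
  by case: [disjoint e & Y].
have aux D i i' t w y K : i <= i' + t -> t < D * y -> 0 < y <= 2 ->
    2 * i' + w <= 2 * (D * w) + K -> 2 * i + (w + y) <= 2 * (D * (w + y)) + K.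
  by clear; rewrite mulnDr; move: (D * w) (D * y); lia.
by rewrite cW'; apply: aux le2 few cY le.
Qed.

End IrreducibleRich.

(** * Exact bound from a set with many rich vertices *)

Section RichStructure.
Variables (T : finType) (H : {set {set T}}) (r a : nat) (A : {set T}).
Hypothesis hr : 3 <= r.
Hypothesis ha : r + 6 <= a.
Hypothesis uH : forall e, e \in H -> #|e| = r.
Hypothesis cA : #|A| = a.

Lemma richP y t g : y \in rich H A -> t \in A ->
  y \notin A /\ exists f, [/\ f \in H, y \in f, t \in f, f \subset y |: A & f != g].
Proof.
rewrite inE in_setC => /andP[yA /forall_inP h] tA; split=> //.
have := h _ tA; rewrite (cardsD1 g).
have aux (b : bool) k : 1 < b + k -> 0 < k by case: b; clear; lia.
move/aux/card_gt0P=> [f]; rewrite !inE => /and5P[fg fH yf tf fs].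
by exists f.
Qed.

(** The path alternates between the two lists and ends in a rich vertex. Each edge has exactly one
    vertex outside [A], so a repetition is possible only at one rich vertex, where two different
    edges are chosen. *)
Lemma rich_path t ts ys : uniq (t :: ts) -> {subset t :: ts <= A} ->
  uniq ys -> {subset ys <= rich H A} -> size ys = (size ts).+1 ->
  exists l, [/\ bpath H t l, size l = 2 * size ts + 1,
    forall u, u \in verts t l -> u \in t :: ts \/ u \in ys
    & forall e, e \in unzip1 l -> exists y, [/\ y \in ys, y \in e & e \subset y |: A]].
Proof.
elim: ts t ys => [|t2 ts IH] t [|y ys] //.
  move=> _ tA _ ysr /eqP; rewrite /= eqSS size_eq0 => /eqP ys0; subst ys.
  have yr : y \in rich H A by apply: ysr; rewrite inE.
  have tA' : t \in A by apply: tA; rewrite inE.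
  have [yA [f [fH yf tf fs _]]] := richP set0 yr tA'.
  have ty : t != y by apply: contraNneq yA => <-.
  exists [:: (f, y)]; split=> //.
  - by rewrite bpath_cons fH tf yf !inE ty.
  - by move=> u; rewrite !inE => /orP[->|->]; [left|right].
  - by move=> e; rewrite inE => /eqP ->; exists y; rewrite inE eqxx.
move=> /andP[tn u2] sA /= /andP[yn uys] ysr [sz].
have yr : y \in rich H A by apply: ysr; rewrite inE eqxx.
have tA : t \in A by apply: sA; rewrite inE eqxx.
have t2A : t2 \in A by apply: sA; rewrite !inE eqxx orbT.
have [||l [b szl vl el]] := IH t2 ys u2 _ uys _ sz.
- by move=> z zt; apply: sA; rewrite inE zt orbT.
- by move=> z zy; apply: ysr; rewrite inE zy orbT.
have ynA z : z \in y :: ys -> z \notin A by move/ysr => zr; case: (richP set0 zr tA).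
have yA : y \notin A by apply: ynA; rewrite inE eqxx.
have [_ [f [fH yf tf fs _]]] := richP set0 yr tA.
have [_ [f' [fH' yf' tf' fs' ff']]] := richP f yr t2A.
have yl : y \notin verts t2 l.
  apply/negP => /vl[yt|]; last by apply/negP.
  by case/negP: yA; apply: sA; rewrite inE yt orbT.
have tl : t \notin verts t2 l.
  apply/negP => /vl[|ty]; first by apply/negP.
  by have := ynA t; rewrite inE ty orbT => /(_ isT); rewrite tA.
have ty : t != y by apply: contraNneq yA => <-.
have fresh (g : {set T}) : y \in g -> g \notin unzip1 l.
  move=> yg; apply/negP => /el[y' [y'y _ /subsetP/(_ _ yg)]].
  rewrite in_setU1 (negPf yA) orbF => /eqP E.
  by case/negP: yn; rewrite E.
exists ((f, y) :: (f', t2) :: l); split.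
- have tn' : t \notin verts y ((f', t2) :: l).
    by rewrite -[verts y _]/(y :: verts t2 l) inE negb_or ty.
  have fn : f \notin unzip1 ((f', t2) :: l).
    by rewrite /unzip1 map_cons inE negb_or eq_sym ff' fresh.
  by rewrite !bpath_cons fH tf yf tn' fn fH' yf' tf' yl (fresh _ yf') b.
- by rewrite /= szl mulnS.
- move=> u; rewrite 2!inE => /or3P[/eqP->|/eqP->|u3].
  + by left; rewrite inE eqxx.
  + by right; rewrite inE eqxx.
  + by case: (vl u u3) => h; [left|right]; rewrite inE h orbT.
- move=> e; rewrite 2!inE => /or3P[/eqP->|/eqP->|/el[y' [h1 h2 h3]]].
  + by exists y; rewrite inE eqxx.
  + by exists y; rewrite inE eqxx.
  + by exists y'; rewrite inE h1 orbT.
Qed.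

Hypothesis big : a + 2 <= #|rich H A|.

(* A path alternating between A and rich vertices uses all of A and has 2a - 1
   edges. *)
Lemma rich_path_avoid t u v : t \in A ->
  exists l, [/\ bpath H t l, size l = 2 * a - 1,
    forall x, x \in verts t l -> x \in A \/ (x \in rich H A /\ x \notin [:: u; v])
    & forall e, e \in unzip1 l ->
        exists y, [/\ y \in rich H A, y \notin [:: u; v], y \in e & e \subset y |: A]].
Proof.
move=> tA; set Y := rich H A :\: [set u; v].
have cY : a <= #|Y|.
  have cuv : #|rich H A :&: [set u; v]| <= 2.
    apply: leq_trans (_ : #|[set u; v]| <= _); last by rewrite cards2; case: (_ != _).
    by apply: subset_leq_card; apply: subsetIr.
  have aux k i y : a + 2 <= k -> i <= 2 -> k = i + y -> a <= y by clear; lia.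
  by apply: aux big cuv _; rewrite cardsID.
have YP z : z \in take a (enum Y) -> z \in rich H A /\ z \notin [:: u; v].
  by move/mem_take; rewrite mem_enum in_setD => /andP[h ->]; split=> //; move: h; rewrite !inE.
have ca : (size (enum (A :\ t))).+1 = a.
  by rewrite -cardE; move: cA; rewrite (cardsD1 t) tA.
have mA z : z \in t :: enum (A :\ t) -> z \in A.
  by rewrite inE mem_enum !inE => /orP[/eqP->|/andP[]].
have [||||| l [b sz vl el]] := @rich_path t (enum (A :\ t)) (take a (enum Y)).
- by rewrite /= enum_uniq mem_enum !inE eqxx.
- exact: mA.
- by apply: take_uniq; apply: enum_uniq.
- by move=> z /YP[].
- by rewrite size_takel ?ca // -cardE.
exists l; split=> //.
- have aux k : k.+1 = a -> 2 * k + 1 = 2 * a - 1 by clear; lia.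
  by rewrite sz; apply: aux ca.
- by move=> x /vl[/mA|/YP]; [left|right].
- by move=> e /el[y [/YP[h1 h2] h3 h4]]; exists y.
Qed.

Variables (m1 m2 : nat).
Hypothesis m2_pos : 0 < m2.
Hypothesis m12 : m1 + m2 = 2 * a.
Hypothesis m21 : m2 <= m1.
Hypothesis nC : ~~ contains_Berge (disjoint_union (path_graph m1) (path_graph m2)) H.

Lemma no_long_path v l : bpath H v l -> size l <= 2 * a.
Proof.
move=> b; rewrite -m12 leqNgt; apply: contra nC => lt.
exact: contains_long_path b lt.
Qed.

(** Going from [v] by [e] to [u], by [g] to [t], and on along an alternating path that avoids [u]
    and [v], gives 2 + (2a - 1) edges, one too many. *)
Lemma two_edges_absurd u e g v t : u \notin A -> e \in H -> g \in H -> e != g ->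
  u \in e -> u \in g -> v \in e -> v \notin A -> v != u -> t \in g -> t \in A -> False.
Proof.
move=> uA eH gH eg ue ug ve vA vu tg tA.
have [l [b sz vl el]] := rich_path_avoid u v tA.
have fresh (f : {set T}) x : x \in [:: u; v] -> x \in f -> x \notin A -> f \notin unzip1 l.
  move=> xuv xf xA; apply/negP => /el[y [_ yuv _ /subsetP/(_ _ xf)]].
  rewrite in_setU1 (negPf xA) orbF => /eqP E; by case/negP: yuv; rewrite -E.
have nv x : x \in [:: u; v] -> x \notin A -> x \notin verts t l.
  move=> xuv xA; apply/negP => /vl[|[_]]; first by apply/negP.
  by rewrite xuv.
have uu : u \in [:: u; v] by rewrite inE eqxx.
have vv : v \in [:: u; v] by rewrite !inE eqxx orbT.
have bb : bpath H v ((e, u) :: (g, t) :: l).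
  rewrite !bpath_cons eH ve ue gH ug tg b (nv _ uu uA) (fresh g u) //=.
  rewrite !inE !negb_or vu eg (fresh e u) //= !andbT.
  by have := nv _ vv vA; rewrite inE negb_or.
have a0 : 0 < a by move: ha; clear; lia.
have := no_long_path bb; rewrite /= sz; move: a0; clear; lia.
Qed.

Lemma A_nonempty : exists t, t \in A.
Proof. by apply/card_gt0P; rewrite cA; move: ha; clear; lia. Qed.

(** If all edges at [u] lie in [u |: A], count them there. An edge leaving this set must be [g]
    itself, and then any second edge at [u] again gives a path that is too long. *)
Lemma degree_attached u g t : u \notin A -> g \in H -> u \in g -> t \in g -> t \in A ->
  #|[set e in H | u \in e]| <= 'C(a, r.-1).
Proof.
move=> uA gH ug tg tA.
have [all_in|] := boolP [forall e in H, (u \in e) ==> (e \subset u |: A)].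
  apply: leq_trans (card_edges_at (y := u) (Z := u |: A) (r := r) _ _) _.
  - by rewrite !inE eqxx.
  - move=> e; rewrite inE => /andP[eH ue]; split=> //; last exact: uH.
    by move/forall_inP: all_in => /(_ _ eH)/implyP; apply.
  - by rewrite cardsU1 uA cA.
rewrite negb_forall_in => /exists_inP[e eH]; rewrite negb_imply => /andP[ue /subsetPn[v ve]].
rewrite in_setU1 negb_or => /andP[vu vA].
have eg : e = g.
  by apply/eqP/negPn/negP => ne; apply: (two_edges_absurd uA eH gH ne ue ug ve vA vu tg tA).
apply: leq_trans (_ : #|[set e]| <= _); last first.
  by rewrite cards1 bin_gt0; move: hr ha; clear; lia.
apply: subset_leq_card; apply/subsetP => e'; rewrite !inE => /andP[eH' ue'].
apply/negPn/negP => ne.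
have [sub|/subsetPn[v' ve']] := boolP (e' \subset u |: A); last first.
  rewrite in_setU1 negb_or => /andP[vu' vA'].
  by apply: (two_edges_absurd uA eH' gH _ ue' ug ve' vA' vu' tg tA); rewrite -eg.
have [t' te' tu] : exists2 t', t' \in e' & t' != u.
  have : 0 < #|e' :\ u|.
    by have := uH eH'; rewrite (cardsD1 u) ue' => E; move: hr; rewrite -E; clear; lia.
  by case/card_gt0P=> t'; rewrite !inE => /andP[h1 h2]; exists t'.
have tA' : t' \in A by have := subsetP sub _ te'; rewrite in_setU1 (negPf tu).
by apply: (two_edges_absurd uA eH eH' _ ue ue' ve vA vu te' tA'); rewrite eq_sym.
Qed.

Lemma rich_bound : #|H| <= 'C(a, r.-1) * (#|T| - a) + 'C(a, r).
Proof.
pose U1 := [set u in ~: A | [exists g in H, (u \in g) && [exists t in A, t \in g]]].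
pose U3 := ~: A :\: U1.
have U13 : #|U1| + #|U3| = #|T| - a.
  rewrite -cA -(cardsC A) addKn -(cardsID U1 (~: A)); congr (_ + _).
  rewrite (setIidPr _) //; apply/subsetP => u; rewrite inE => /andP[].
  by [].
(* Rich vertices belong to [U1], so an alternating path, whose 2a - 1 edges are at least m1, is
   disjoint from everything inside [U3]. *)
have free3 v l : bpath (inner H U3) v l -> size l < m2.
  move=> b; rewrite ltnNge; apply/negP => szl.
  have [t tA] := A_nonempty.
  have [l1 [b1 sz1 vl1 el1]] := rich_path_avoid t t tA.
  have {}b := bpath_take m2 b; have szt : size (take m2 l) = m2 by rewrite size_takel.
  move: (take m2 l) b szt => {szl}l b szt.
  have inU3 u : u \in verts v l -> u \in U3.
    have edge3 e : e \in inner H U3 -> e \subset U3 by rewrite inE => /andP[].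
    rewrite inE => /orP[/eqP->|ul].
      move: b szt m2_pos; case: (l) => [|[e x] l2]; first by move=> _ <-.
      rewrite bpath_cons => /and5P[e3 ve _ _ _] _ _.
      exact: (subsetP (edge3 _ e3)).
    have [e el ue] := bpath_vert_edge (proj1 (andP b)) ul.
    exact: (subsetP (edge3 _ (bpath_mem_edges b el))).
  have A3 u : u \in U3 -> u \notin A by rewrite !inE => /andP[].
  have rich3 y : y \in rich H A -> y \notin U3.
    move=> yr; have [yA [f [fH yf tf _ _]]] := richP set0 yr tA.
    rewrite in_setD in_setC yA andbT negbK inE in_setC yA /=.
    by apply/exists_inP; exists f => //; rewrite yf; apply/exists_inP; exists t.
  have sz1' : size (take m1 l1) = m1.
    by rewrite size_takel // sz1; move: m12 m2_pos; clear; lia.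
  have bH : bpath H v l by apply: bpath_sub b; apply/subsetP => e; rewrite inE => /andP[].
  case/negP: nC; rewrite -sz1' -szt.
  apply: (contains_two_paths (v1 := t) (v2 := v)) => //; first exact: bpath_take.
  - move=> u; rewrite /verts inE /unzip2 map_take => ut; apply/negP => /inU3 u3.
    have : u \in verts t l1.
      by rewrite inE; case/orP: ut => [->//|/mem_take ->]; rewrite orbT.
    by case/vl1 => [uA|[/rich3 /negP//]]; have := A3 _ u3; rewrite uA.
  - move=> e; rewrite /unzip1 map_take => /mem_take/el1[y [yr _ ye _]]; apply/negP => el.
    have := bpath_mem_edges b el; rewrite inE => /andP[_ /subsetP/(_ _ ye)].
    by apply/negP; apply: rich3.
have c3 : #|inner H U3| <= 'C(a, r.-1) * #|U3|.
  apply: (@card_path_free T r m2) => //.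
  - by move: hr; clear; lia.
  - have ma : m2.-1 <= a.-1 by move: m12 m21; clear; lia.
    have h1 := leq_bin2l r.-1 ma.
    have h2 : kappa r m2.-1 <= kappa r a.+1 by apply: leq_kappa; move: ma; clear; lia.
    have gap := binom_gap hr ha; rewrite (binom_pred hr ha).
    have aux c1 c2 c3 k k' : c1 <= c2 -> k <= k' -> 2 * k' + 2 < c3 -> c1 + k <= c2 + c3 by clear; lia.
    exact: aux h1 h2 gap.
  - by move=> e; rewrite inE => /andP[/uH].
  - by move=> e; rewrite inE => /andP[].
(* An edge that meets both [A] and its complement has all its outer vertices in [U1]. *)
have cover : H \subset inner H A :|: (\bigcup_(u in U1) [set e in H | u \in e] :|: inner H U3).
  apply/subsetP => e eH; rewrite 2!in_setU inE eH /=.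
  have [//|/subsetPn[w we wA]] := boolP (e \subset A); rewrite orFb.
  have [/exists_inP[u ue uU]|] := boolP [exists u in e, u \in U1].
    by apply/orP; left; apply/bigcupP; exists u => //; rewrite inE eH.
  rewrite negb_exists_in => /forall_inP no1; apply/orP; right; rewrite inE eH /=.
  apply/subsetP => u ue; rewrite in_setD in_setC no1 //=.
  apply: contra (no1 _ we) => uA; rewrite inE in_setC wA /=.
  by apply/exists_inP; exists e => //; rewrite we; apply/exists_inP; exists u.
apply: leq_trans (subset_leq_card cover) _.
apply: leq_trans (leq_card_setU _ _) _; rewrite addnC; apply: leq_add.
  apply: leq_trans (leq_card_setU _ _) _; rewrite -U13 mulnDr; apply: leq_add => //.
  apply: leq_trans (_ : \sum_(u in U1) #|[set e in H | u \in e]| <= _).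
    elim/big_rec2: _ => [|u c B _ le]; first by rewrite cards0.
    by apply: leq_trans (leq_card_setU _ _) _; rewrite leq_add2l.
  rewrite mulnC -sum_nat_const; apply: leq_sum => u; rewrite inE in_setC => /andP[uA].
  case/exists_inP=> g gH /andP[ug /exists_inP[t tA tg]].
  exact: (degree_attached uA gH ug tg tA).
rewrite -{1}cA -cards_draws; apply: subset_leq_card; apply/subsetP => e.
by rewrite !inE => /andP[/uH -> ->] /=.
Qed.

End RichStructure.

(** * The theorem *)

(** Connecting paths in [A] never leave the component, so they are paths of the relation restricted
    to [X]. *)
Lemma comps_conn (T : finType) (H : {set {set T}}) (A X : {set T}) :
  X \in comps H A -> conn H X.
Proof.
move=> XA x y xX yX; apply/negPn/negP => nc.
have [||u [u' [uP u'P /and3P[uA u'A uu'] _]]] :=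
    connect_exit (P := mem (comp H X x)) (comps_connect XA xX yX).
- exact: mem_comp.
- by rewrite /= inE yX.
have [uX xu] : u \in X /\ connect (cadj H X) x u by move: uP; rewrite /= inE => /andP[].
have u'X := comps_closed XA uX u'A uu'.
case/negP: u'P; rewrite /= inE u'X /=; apply: connect_trans xu _.
by apply: connect1; rewrite /cadj uX u'X.
Qed.

(** The first two summands are the error of [reduce], the third pays for replacing n by n - a, and
    the last ensures a <= n. *)
Definition union_threshold (r a : nat) : nat :=
  2 * 2 ^ large_bound r a + large_bound r a + 2 * ('C(a, r.-1) * a) + a.

Lemma union_upper (T : finType) (H : {set {set T}}) r a m1 m2 :
  3 <= r -> r + 6 <= a -> 0 < m2 -> m2 <= m1 -> m1 + m2 = 2 * a ->
  (forall e, e \in H -> #|e| = r) ->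
  ~~ contains_Berge (disjoint_union (path_graph m1) (path_graph m2)) H ->
  contains_Berge (path_graph m1) H -> union_threshold r a <= #|T| ->
  #|H| <= 'C(a, r.-1) * (#|T| - a) + 'C(a, r).
Proof.
move=> hr ha m20 m21 m12 uH nC /contains_pathE[v [l [b sz]]] big.
have nop := no_long_path m12 nC.
pose C := comp H setT v; pose R := ~: C.
have CC : C \in comps H setT by apply: comps_comp; rewrite inE.
have vC u : u \in verts v l -> u \in C.
  move=> ul; rewrite inE in_setT /=; apply: walk_connect ul; first by case/and3P: b.
  by move=> z _; rewrite in_setT.
have edgeCR e : e \in H -> (e \subset C) || (e \subset R).
  move=> eH; have [//|/subsetPn[x xe xC]] := boolP (e \subset C); rewrite orFb.
  apply/subsetP => u ue; rewrite in_setC; apply: contra xC => uC.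
  by apply: (comps_closed CC uC); rewrite ?in_setT // (adjI eH ue xe).
(* A path with m2 edges inside [R] would be disjoint from the m1-edge path in [C]. The strict
   [binom_gap] saves one edge per vertex here. *)
have cR : #|inner H R| <= ('C(a, r.-1)).-1 * #|R|.
  apply: (@card_path_free T r m2) => //.
  - by move: hr; clear; lia.
  - have ma : m2.-1 <= a.-1 by move: m12 m21; clear; lia.
    have h1 := leq_bin2l r.-1 ma.
    have h2 : kappa r m2.-1 <= kappa r a.+1 by apply: leq_kappa; move: ma; clear; lia.
    have gap := binom_gap hr ha; rewrite (binom_pred hr ha).
    have aux c1 c2 c3 k k' : c1 <= c2 -> k <= k' -> 2 * k' + 2 < c3 ->
      c1 + k <= (c2 + c3).-1 by clear; lia.
    exact: aux h1 h2 gap.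
  - by move=> e; rewrite inE => /andP[/uH].
  - by move=> e; rewrite inE => /andP[].
  - move=> v2 l2 b2; rewrite ltnNge; apply/negP => szl.
    have {}b2 := bpath_take m2 b2; have szt : size (take m2 l2) = m2 by rewrite size_takel.
    move: (take m2 l2) b2 szt => {szl}l2 b2 szt.
    have inR u : u \in verts v2 l2 -> u \in R.
      have edgeR e : e \in inner H R -> e \subset R by rewrite inE => /andP[].
      rewrite inE => /orP[/eqP->|ul].
        move: b2 szt m20; case: (l2) => [|[e x] l3]; first by move=> _ <-.
        rewrite bpath_cons => /and5P[e3 ve _ _ _] _ _.
        exact: (subsetP (edgeR _ e3)).
      have [e el ue] := bpath_vert_edge (proj1 (andP b2)) ul.
      exact: (subsetP (edgeR _ (bpath_mem_edges b2 el))).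
    have bH : bpath H v2 l2 by apply: bpath_sub b2; apply/subsetP => e; rewrite inE => /andP[].
    case/negP: nC; rewrite -sz -szt; apply: (contains_two_paths b bH).
    + by move=> u /vC uC; apply/negP => /inR; rewrite in_setC uC.
    + move=> e el; apply/negP => el2.
      have [_ [_ [u [_ ul _ ue _]]]] := bpath_edge b el.
      have := bpath_mem_edges b2 el2; rewrite inE => /andP[_ /subsetP/(_ _ ue)].
      by rewrite in_setC vC // inE ul orbT.
have cH : #|H| <= #|inner H C| + #|inner H R|.
  apply: leq_trans (leq_card_setU _ _); apply: subset_leq_card; apply/subsetP => e eH.
  by rewrite !inE eH /=; apply: edgeCR.
have [le|[W [cW bigW irr]]] := reduce r a (comps_conn CC); last first.
  have [A [cA cr]] := irreducible_rich hr ha uH nop cW irr bigW.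
  exact: (rich_bound hr ha uH cA cr m20 m12 m21 nC).
apply: leq_trans (leq_addr _ _).
have cT : #|T| = #|C| + #|R| by rewrite cardsC.
have D0 : 0 < 'C(a, r.-1) by rewrite bin_gt0; move: hr ha; clear; lia.
(* Half an edge is saved per vertex of [C] and a whole one per vertex of [R]; for large n this
   outweighs the constant [K] and the term [D * a]. *)
have aux D h i j c q K : 0 < D -> h <= i + j -> 2 * i + c <= 2 * (D * c) + K ->
    j <= D.-1 * q -> K + 2 * (D * a) + a <= c + q -> h <= D * (c + q - a).
  case: D => // D _; rewrite mulnBr mulnDr /=.
  have := mulSn D q; move: (D.+1 * c) (D.+1 * q) (D.+1 * a) (D * q); clear; lia.
by rewrite cT; apply: aux D0 cH le cR _; rewrite -cT.
Qed.

(** Only the half-sum [a] has to be large, so one statement covers both parts. A graph without the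
    longer path is counted by the first term of the maximum, any other by [union_upper]. *)
Lemma ex_Berge_union r a m1 m2 : 3 <= r -> r + 6 <= a -> odd m1 -> odd m2 ->
  m2 <= m1 -> m1 + m2 = 2 * a ->
  exists n0 : nat, forall n : nat, n0 <= n ->
    ex_Berge r n (disjoint_union (path_graph m1) (path_graph m2)) =
    maxn (ex_Berge r n (path_graph m1)) ('C(a, r.-1) * (n - a) + 'C(a, r)).
Proof.
move=> hr ha o1 o2 m21 m12; exists (union_threshold r a) => n big.
have m20 : 0 < m2 by case: (m2) o2.
have an : a <= n by apply: leq_trans big; apply: leq_addl.
apply/eqP; rewrite eqn_leq geq_max; apply/and3P; split.
- apply/bigmax_leqP => H /andP[/forall_inP u nC].
  have uH e : e \in H -> #|e| = r by move/u/eqP.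
  rewrite leq_max; have [c|nc] := boolP (contains_Berge (path_graph m1) H).
    have := union_upper hr ha m20 m21 m12 uH nC c; rewrite card_ord => h.
    by rewrite h // orbT.
  apply/orP; left; rewrite /ex_Berge.
  by apply: (leq_bigmax_cond (F := fun H : {set {set 'I_n}} => #|H|)); rewrite nc andbT; apply/forall_inP.
- apply/bigmax_leqP => H /andP[u nc]; rewrite /ex_Berge.
  apply: (leq_bigmax_cond (F := fun H : {set {set 'I_n}} => #|H|)).
  by rewrite u /=; apply: contra nc; apply: contains_unionW.
- pose A := [set i in take a (enum 'I_n)].
  have cA : #|A| = a.
    by rewrite cardsE (card_uniqP (take_uniq _ (enum_uniq _))) size_takel // size_enum_ord.
  apply: leq_trans (_ : #|star_edges A r| <= _).
    have := @card_star_edges _ A r; rewrite card_ord cA; apply.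
    by move: hr; clear; lia.
  apply: (leq_bigmax_cond (F := fun H : {set {set 'I_n}} => #|H|)); apply/andP; split.
    by apply/forall_inP => e; rewrite inE => /andP[].
  by apply: star_edges_free => //; rewrite cA m12 mul2n doubleK.
Qed.

Theorem theorem2p10 (r : nat) (hr : 3 <= r) :
  (forall l : nat, odd l -> 2 * r + 11 <= l ->
     exists n0 : nat, forall n : nat, n0 <= n ->
       ex_Berge r n (disjoint_union (path_graph l) (path_graph 1)) =
       maxn (ex_Berge r n (path_graph l))
            ('C((l + 1) %/ 2, r - 1) * (n - (l + 1) %/ 2)
             + 'C((l + 1) %/ 2, r)))
  /\
  (forall l1 l2 : nat, odd l1 -> odd l2 -> l2 <= l1 -> r + 6 <= l2 ->
     exists n0 : nat, forall n : nat, n0 <= n ->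
       ex_Berge r n (disjoint_union (path_graph l1) (path_graph l2)) =
       maxn (ex_Berge r n (path_graph l1))
            ('C((l1 + l2) %/ 2, r - 1) * (n - (l1 + l2) %/ 2)
             + 'C((l1 + l2) %/ 2, r))).
Proof.
split.
- move=> l ol hl.
  (* For m2 = 1 the condition r + 6 <= a reads 2r + 11 <= l. *)
  have [|||n0 hn0] := @ex_Berge_union r ((l + 1) %/ 2) l 1 hr _ ol isT; try lia.
  by exists n0 => n nn; rewrite subn1; apply: hn0.
- move=> l1 l2 o1 o2 h21 h2.
  (* The half-sum is at least the smaller length [l2]. *)
  have [|||n0 hn0] := @ex_Berge_union r ((l1 + l2) %/ 2) l1 l2 hr _ o1 o2; try lia.
  by exists n0 => n nn; rewrite subn1; apply: hn0.
Qed.
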